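(* For any positive integers $k\ge 5$ and $n\ge \frac{k+2}{2}$, the distributive lattice $\mathbf{(n+k)}\times\mathbf{n}$ is not Schur positive; that is, the chromatic symmetric function $X_{\mathrm{inc}(\mathbf{(n+k)}\times\mathbf{n})}$ is not a nonnegative linear combination of Schur functions.
   Context: $\mathbf{m}$ denotes the $m$-element chain $1<2<\cdots<m$, and $\mathbf{m}\times\mathbf{n}$ is the product poset (componentwise order). For a poset $P$, its incomparability graph $\mathrm{inc}(P)$ has vertex set $P$ and an edge between $x\ne y$ whenever $x,y$ are incomparable in $P$. For a graph $G=(V,E)$, Stanley's chromatic symmetric function is $X_G=\sum_\kappa\prod_{v\in V}x_{\kappa(v)}$, summed over all proper colorings $\kappa:V\to\{1,2,\ldots\}$ (i.e. $\kappa(u)\ne\kappa(v)$ whenever $uv\in E$). A poset $P$ is called Schur positive if $X_{\mathrm{inc}(P)}$ has nonnegative coefficients in the Schur function basis $\{s_\lambda\}$. *)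

(* Defs.v *)
From HB Require Import structures.
From mathcomp Require Import all_boot all_order all_algebra.
From mathcomp Require Import finmap.
From mathcomp Require Import boolp classical_sets fsbigop.

Set Implicit Arguments.
Unset Strict Implicit.
Unset Printing Implicit Defensive.

Import Order.TTheory GRing.Theory Num.Theory.

Local Open Scope ring_scope.

(* An exponent vector m stands for the monomial \prod_i x_i ^ (m i).  The      *)
(* variables x_1, x_2, ... are indexed here from 0, i.e. by all of nat.       *)
Definition expvec := {fsfun nat -> nat with 0%N}.

(* Formal power series in countably many variables, given by coefficients.    *)
Definition fps := expvec -> rat.

(* \sum_(f | P f) \prod_(a : A) x_(f a).  For every m only finitely many f    *)
(* are summed, since such an f takes its values in the support of m, so the   *)
(* convention that \sum_(_ \in _) is 0 on infinite supports never applies.    *)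
Definition genseries (A : finType) (P : {ffun A -> nat} -> Prop) : fps :=
  fun m => \sum_(f \in [set f : {ffun A -> nat} |
    P f /\ forall i : nat, #|[set a | f a == i]%SET| = m i]%classic) (1 : rat).

Section Graph.
Variables (V : finType) (e : rel V).

Definition proper_coloring (kappa : {ffun V -> nat}) : Prop :=
  forall u v : V, e u v -> kappa u <> kappa v.

Definition chromatic_symfun : fps := genseries proper_coloring.

End Graph.

Definition is_partition (s : seq nat) : bool := sorted geq s && (0%N \notin s).

Definition intpartition := {s : seq nat | is_partition s}.

(* Cells (i, j) of the Young diagram: row i < size la, column j < la_i.       *)
Definition cell (la : intpartition) : finType :=
  {i : 'I_(size (val la)) & 'I_(nth 0%N (val la) i)}.

Definition cell_row (la : intpartition) (c : cell la) : nat := tag c.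

Definition cell_col (la : intpartition) (c : cell la) : nat := tagged c.

Definition semistandard (la : intpartition) (T : {ffun cell la -> nat}) : Prop :=
  forall c d : cell la,
    (cell_row c = cell_row d -> (cell_col c < cell_col d)%N -> (T c <= T d)%N) /\
    (cell_col c = cell_col d -> (cell_row c < cell_row d)%N -> (T c < T d)%N).

Definition schur (la : intpartition) : fps := genseries (@semistandard la).

Definition schur_nonneg (F : fps) : Prop :=
  exists c : {fsfun intpartition -> rat with 0},
    (forall la, 0 <= c la) /\
    (forall m : expvec, F m = \sum_(la <- finsupp c) c la * schur la m).

Definition inc (d : Order.disp_t) (P : finPOrderType d) : rel P :=
  fun x y => (x >< y)%O.

Definition schur_positive (d : Order.disp_t) (P : finPOrderType d) : Prop :=
  schur_nonneg (chromatic_symfun (@inc d P)).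

(* Main.v *)
Require Import Defs.
From mathcomp Require Import boolp classical_sets fsbigop.
From mathcomp Require Import all_boot all_order all_algebra.
From mathcomp Require Import finmap zify.

(* Let N = n - 1 and nu = (k - 3, 2, 2).  The coefficient in X of the Schur
   function indexed by (2N+k+1, 2N+k-1, ..., k+3, nu) turns out to be negative.
   Expanding a Jacobi-Trudi determinant, it is an alternating sum L of six
   monomial coefficients of X: the exponents of all but three
   variables are 2N+k+1-2i (i < N), the other three are (2, 2, k-3),
   (1, 1, k-1), (0, 3, k-2) with sign + and (1, 2, k-2), (1, 3, k-3), (0, 2, k-1)
   with sign -.

   L is nonnegative on every Schur function: an injection from negative to
   positive tableaux changes only the cells (0,0), (0,1) and (1,1).

   For X, the N big colours are forced to occupy as many cells of each rank
   level as possible, which leaves exactly one cell in each of the k + 1 levels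
   with n cells, in weakly descending rows.  Hence each coefficient is a common
   positive factor times the number of words of length k + 1 in pairs (row,
   colour) with descending rows, in which a colour stays in a single row.
   Counting these words gives
     L / factor = n * (k+1)k(k-3)(k-4)/12 - n * N * (k-4)(k^2-2k+9)/6,
   and this is negative as soon as 2N >= k. *)

Set Implicit Arguments.
Unset Strict Implicit.
Unset Printing Implicit Defensive.

Import Order.TTheory GRing.Theory Num.Theory.

(** * Tableaux *)

(** Variables of index at least [M] do not occur in the monomial, so a counted function takes values
    below [M]. The finitely supported sum over functions into [nat] thus becomes the cardinality of
    a finite set. *)
Lemma genseries_card (A : finType) (P : {ffun A -> nat} -> Prop) (m : expvec)
    (M : nat) : (forall i, M <= i -> m i = 0) ->
  genseries P m = (#|[set f : {ffun A -> 'I_M} |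
     `[< P [ffun a => f a : nat] >] &&
     [forall i : 'I_M, #|[set a | f a == i]| == m i]]|%:R)%R.
Proof.
move=> m0; set S := finset _.
pose emb (f : {ffun A -> 'I_M}) : {ffun A -> nat} := [ffun a => f a : nat].
have emb_inj : injective emb.
  move=> f g /ffunP fg; apply/ffunP => a; have := fg a; rewrite !ffunE.
  exact: val_inj.
have cntE (f : {ffun A -> 'I_M}) (i : 'I_M) :
    [set a | emb f a == i] = [set a | f a == i].
  by apply/setP => a; rewrite !inE ffunE.
rewrite /genseries.
rewrite (_ : [set f | _]%classic = (emb @` [set` S])%classic); last first.
  apply/seteqP; split => [f [Pf fm]|_ [f /= fS <-]].
    have fM a : f a < M.
      rewrite ltnNge; apply/negP => /m0; rewrite -fm => /eqP.
      by rewrite cards_eq0 => /eqP /setP/(_ a); rewrite !inE eqxx.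
    pose g : {ffun A -> 'I_M} := [ffun a => Ordinal (fM a)].
    have fE : f = emb g by apply/ffunP => a; rewrite !ffunE.
    exists g => //=; rewrite inE -/(emb g) -fE; apply/andP; split; first exact/asboolP.
    by apply/forallP => i; rewrite -cntE -fE fm.
  move: fS; rewrite inE => /andP[/asboolP Pf /forallP fm]; split => // i.
  have [iM|Mi] := ltnP i M; first by rewrite -(eqP (fm (Ordinal iM))) -cntE.
  rewrite m0 //; apply/eqP; rewrite cards_eq0; apply/eqP/setP => a.
  by rewrite !inE ffunE; apply/eqP => fi; move: (ltn_ord (f a)); rewrite fi ltnNge Mi.
rewrite fsbig_image; last by move=> f g _ _; apply: emb_inj.
rewrite (_ : [set` S]%classic = [set` enum S]%classic); last first.
  by apply/seteqP; split => f /=; rewrite mem_enum.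
by rewrite -fsbig_seq ?enum_uniq // big_enum /= sumr_const.
Qed.

Lemma card_preim_update (A : finType) (B : eqType) (f : A -> B) (e : A) (v u : B) :
  #|[set a | (if a == e then v else f a) == u]| + (f e == u)
  = #|[set a | f a == u]| + (v == u).
Proof.
rewrite (cardsD1 e) [in RHS](cardsD1 e) !inE eqxx.
have -> : [set a | (if a == e then v else f a) == u] :\ e = [set a | f a == u] :\ e.
  by apply/setP => a; rewrite !inE; case: eqP.
by lia.
Qed.

Section Tableaux.
Variable la : intpartition.
Let part i := nth 0 (val la) i.

Lemma cell_coord_inj (c d : cell la) :
  cell_row c = cell_row d -> cell_col c = cell_col d -> c = d.
Proof.
case: c d => [i j] [i' j']; rewrite /cell_row /cell_col /= => /val_inj ii'.
by move: j j'; rewrite -ii' => j j' /val_inj ->.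
Qed.

Lemma cell_at i j : j < part i ->
  exists c : cell la, cell_row c = i /\ cell_col c = j.
Proof.
rewrite /part => jl; have il : i < size (val la).
  by rewrite ltnNge; apply/negP => /(nth_default 0) e; rewrite e in jl.
by exists (Tagged (fun i : 'I_(size (val la)) => 'I_(nth 0 (val la) i))
  (Ordinal jl : 'I_(nth 0 (val la) (Ordinal il)))).
Qed.

Lemma cell_col_lt (c : cell la) : cell_col c < part (cell_row c).
Proof. exact: ltn_ord. Qed.

Lemma part_anti i : part i.+1 <= part i.
Proof.
case: la @part => s /= /andP[ss _]; have [il|] := ltnP i.+1 (size s); last first.
  by move=> /(nth_default 0) ->.
by move: ss => /(sortedP 0)/(_ _ il).
Qed.

Section Row.
Variables (M : nat) (T : {ffun cell la -> 'I_M}).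
Hypothesis sT : semistandard [ffun c => T c : nat].

Lemma ssyt_row c d : cell_row c = cell_row d -> cell_col c <= cell_col d -> T c <= T d.
Proof.
rewrite leq_eqVlt => rE /orP[/eqP cE|cl]; first by rewrite (cell_coord_inj rE cE).
by have := (sT c d).1 rE cl; rewrite !ffunE.
Qed.

Lemma ssyt_col c d : cell_col c = cell_col d -> cell_row c < cell_row d -> T c < T d.
Proof. by move=> cE rl; have := (sT c d).2 cE rl; rewrite !ffunE. Qed.

Lemma ssyt_above i c : cell_row c = i.+1 ->
  exists d, [/\ cell_row d = i, cell_col d = cell_col c & T d < T c].
Proof.
move=> rc; have := cell_col_lt c; rewrite rc => /leq_trans/(_ (part_anti i)).
move=> /cell_at[d [rd cd]]; exists d; split => //.
by apply: ssyt_col; rewrite ?cd ?rd ?rc.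
Qed.

Lemma ssyt_ge_row c : cell_row c <= T c.
Proof.
move: {2}(cell_row c) (erefl (cell_row c)) => i; elim: i c => [|i IH] c rc.
  by rewrite rc.
have [d [rd _ lt]] := ssyt_above rc.
by rewrite rc; apply: leq_ltn_trans lt; rewrite -{1}rd; apply: IH.
Qed.

Let D i v := [set c | (cell_row c == i) && (T c <= v)].

(** Rows increase weakly, so the cells of row [i] with entry at most [v] form an initial segment,
    whose length is [#|D i v|]. Both directions compare lists of columns by their lengths. *)
Lemma ssyt_threshold i v c : cell_row c = i -> (T c <= v) = (cell_col c < #|D i v|).
Proof.
move=> rc; pose s := [seq cell_col d | d <- enum (D i v)].
have us : uniq s.
  rewrite map_inj_in_uniq ?enum_uniq // => d e.
  rewrite !mem_enum !inE => /andP[/eqP rd _] /andP[/eqP re _].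
  by apply: cell_coord_inj; rewrite rd re.
have sz : size s = #|D i v| by rewrite size_map cardE.
rewrite -sz; apply/idP/idP => [Tc|].
  rewrite -(size_iota 0 (cell_col c).+1); apply: uniq_leq_size (iota_uniq _ _) _ => j.
  rewrite mem_iota add0n /= ltnS => jc.
  have [d [rd cd]] := @cell_at i j (leq_ltn_trans jc (eq_ind _ (fun r => _ < part r) (cell_col_lt c) _ rc)).
  apply/mapP; exists d => //; rewrite mem_enum inE rd eqxx /=.
  by apply: leq_trans Tc; apply: ssyt_row; rewrite ?rd ?cd.
apply: contraLR; rewrite -ltnNge -leqNgt => Tc.
rewrite -[leqRHS](size_iota 0); apply: uniq_leq_size us _ => j /mapP[d].
rewrite mem_enum inE => /andP[/eqP rd Td ->]; rewrite mem_iota add0n /=.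
rewrite ltnNge; apply/negP => cd.
by have := ssyt_row (etrans rc (esym rd)) cd; rewrite leqNgt (leq_ltn_trans Td Tc).
Qed.

Lemma threshold_le i v : #|D i v| <= part i.
Proof.
rewrite cardE -(size_map (@cell_col la)) -[leqRHS](size_iota 0); apply: uniq_leq_size.
  rewrite map_inj_in_uniq ?enum_uniq // => d e.
  rewrite !mem_enum !inE => /andP[/eqP rd _] /andP[/eqP re _].
  by apply: cell_coord_inj; rewrite rd re.
move=> j /mapP[d]; rewrite mem_enum inE => /andP[/eqP rd _ ->].
by rewrite mem_iota add0n /= -rd cell_col_lt.
Qed.

(** An entry is at least its row index, so zeros lie in row 0 and ones in rows 0 and 1. Their cells
    are then fixed by the split of the ones: [x] after the zeros of row 0 and [y] at the start of
    row 1, with [y <= a] because each of the latter has a zero above it. *)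
Lemma ssyt_low_letters a b :
  #|[set c | T c == 0 :> nat]| = a -> #|[set c | T c == 1 :> nat]| = b ->
  exists x y, [/\ x + y = b, y <= a, a + x <= part 0, y <= part 1 &
   forall c, (T c = 0 :> nat <-> cell_row c = 0 /\ cell_col c < a) /\
   (T c = 1 :> nat <-> (cell_row c = 0 /\ a <= cell_col c < a + x) \/
                       (cell_row c = 1 /\ cell_col c < y))].
Proof.
move=> Ha Hb.
have a0 : a = #|D 0 0|.
  rewrite -Ha; apply: eq_card => c; rewrite !inE leqn0; apply/idP/andP => [Tc|[]//].
  by have := ssyt_ge_row c; rewrite (eqP Tc) leqn0.
have ab : a + b = #|D 0 1| + #|D 1 1|.
  rewrite -cardsUI (_ : _ :&: _ = set0) ?cards0 ?addn0; last first.
    by apply/setP => c; rewrite !inE; lia.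
  rewrite -Ha -Hb -cardsUI (_ : _ :&: _ = set0) ?cards0 ?addn0; last first.
    by apply/setP => c; rewrite !inE; lia.
  apply: eq_card => c; rewrite !inE; have := ssyt_ge_row c; lia.
have D01 : a <= #|D 0 1|.
  by rewrite a0; apply: subset_leq_card; apply/subsetP => c; rewrite !inE; lia.
have t1 := threshold_le 0 1; have t2 := threshold_le 1 1.
have ya : #|D 1 1| <= a.
  rewrite leqNgt; apply/negP => ay.
  have [c [rc cc]] := cell_at (leq_trans ay t2).
  have [d [rd cd lt]] := ssyt_above rc.
  have := ssyt_threshold 1 rc; have := ssyt_threshold 0 rd; lia.
exists (#|D 0 1| - a), #|D 1 1|; split => //; try lia.
move=> c; have := ssyt_ge_row c.
have := @ssyt_threshold 0 0 c; have := @ssyt_threshold 0 1 c.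
have := @ssyt_threshold 1 1 c; rewrite -a0 => h1 h2 h3 h4; split.
  split => [Tc|[rc cc]]; first by have rc : cell_row c = 0; [lia | move: (h3 rc); lia].
  by move: (h3 rc); lia.
split => [Tc|[[rc cc]|[rc cc]]].
  have [rc|rc] : cell_row c = 0 \/ cell_row c = 1 by lia.
    by left; move: (h3 rc) (h2 rc); lia.
  by right; move: (h1 rc); lia.
  by move: (h3 rc) (h2 rc); lia.
by move: (h1 rc); lia.
Qed.

End Row.
End Tableaux.

(** * Nonnegativity on Schur functions, by injections between tableaux *)

Section CrossingInjection.
Variables (la : intpartition) (w : seq nat).
Local Notation M := (size w).+3.
Local Notation tableau := {ffun cell la -> 'I_M}.

(** The six contents to be compared differ only in the three smallest letters, so that changes near
    the corner of the diagram suffice; [w] is common to all of them. *)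
Definition tableaux (a b c : nat) : {set tableau} :=
  [set T : tableau | `[< semistandard [ffun e => T e : nat] >] &&
     [forall u : 'I_M, #|[set e | T e == u]| == nth 0 [:: a, b, c & w] u]].

Lemma tableauxP a b c (T : tableau) :
  reflect (semistandard [ffun e => T e : nat] /\
           forall u : 'I_M, #|[set e | T e == u]| = nth 0 [:: a, b, c & w] u)
          (T \in tableaux a b c).
Proof.
rewrite inE; apply: (iffP andP) => [[/asboolP sT /forallP cT]|[sT cT]]; split => //.
- by move=> u; apply/eqP/cT.
- exact/asboolP.
- by apply/forallP => u; rewrite cT.
Qed.

Lemma semistandardE (T : tableau) : semistandard [ffun e => T e : nat] <->
  forall e d, (cell_row e = cell_row d -> cell_col e < cell_col d -> T e <= T d) /\
    (cell_col e = cell_col d -> cell_row e < cell_row d -> T e < T d).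
Proof. by split => sT e d; have := sT e d; rewrite !ffunE. Qed.

Definition entry (T : tableau) (i j v : nat) : bool :=
  [exists e, [&& cell_row e == i, cell_col e == j & T e == v :> nat]].

Lemma entryP (T : tableau) i j v :
  reflect (exists e, [/\ cell_row e = i, cell_col e = j & T e = v :> nat])
          (entry T i j v).
Proof.
apply: (iffP existsP) => -[e]; first by move=> /and3P[/eqP ? /eqP ? /eqP ?]; exists e.
by move=> [<- <- <-]; exists e; rewrite !eqxx.
Qed.

Lemma entryE (T : tableau) e i j v :
  cell_row e = i -> cell_col e = j -> entry T i j v = (T e == v :> nat).
Proof.
move=> re ce; apply/entryP/eqP => [[d [rd cd <-]]|Te]; last by exists e.
by rewrite (@cell_coord_inj _ e d) ?re ?ce.
Qed.

Definition update (T : tableau) (i j : nat) (v : 'I_M) : tableau :=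
  [ffun e => if (cell_row e == i) && (cell_col e == j) then v else T e].

Lemma updateE T i j v e :
  update T i j v e = (if (cell_row e == i) && (cell_col e == j) then v : nat else T e) :> nat.
Proof. by rewrite ffunE; case: ifP. Qed.

Lemma update_content T i j v e u : cell_row e = i -> cell_col e = j ->
  #|[set d | update T i j v d == u]| + (T e == u) = #|[set d | T d == u]| + (v == u).
Proof.
move=> re ce.
have -> : [set d | update T i j v d == u] = [set d | (if d == e then v else T d) == u].
  apply/setP => d; rewrite !inE ffunE; congr ((if _ then _ else _) == u).
  apply/andP/eqP => [[/eqP rd /eqP cd]|->]; last by rewrite re ce !eqxx.
  by apply: cell_coord_inj; rewrite ?rd ?cd.
exact: card_preim_update.
Qed.

Lemma tableaux_low a b c T : T \in tableaux a b c ->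
  exists x y, [/\ x + y = b, y <= a, a + x <= nth 0 (val la) 0,
    y <= nth 0 (val la) 1 &
   forall e, (T e = 0 :> nat <-> cell_row e = 0 /\ cell_col e < a) /\
   (T e = 1 :> nat <-> (cell_row e = 0 /\ a <= cell_col e < a + x) \/
                       (cell_row e = 1 /\ cell_col e < y))].
Proof.
move=> /tableauxP[sT cT]; apply: (ssyt_low_letters sT).
  by rewrite -[RHS](cT ord0).
by rewrite -[RHS](cT (Ordinal (isT : 1 < M))).
Qed.

Local Notation l0 := (ord0 : 'I_M).
Local Notation l1 := (Ordinal (isT : 1 < M)).
Local Notation l2 := (Ordinal (isT : 2 < M)).

Lemma leq_card_inj (A B : {set tableau}) (f : tableau -> tableau) :
  (forall T, T \in A -> f T \in B) ->
  (forall T T', T \in A -> T' \in A -> f T = f T' -> T = T') -> #|A| <= #|B|.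
Proof.
move=> fAB finj; rewrite -(card_in_imset (f := f) (D := A)) //.
by apply/subset_leq_card/subsetP => _ /imsetP[T TA ->]; apply: fAB.
Qed.

Lemma update_inj (T T' : tableau) i j v e : cell_row e = i -> cell_col e = j -> T e = T' e ->
  update T i j v = update T' i j v -> T = T'.
Proof.
move=> re ce TT' /ffunP h; apply/ffunP => d; have := h d; rewrite !ffunE.
by case: ifP => // /andP[/eqP rd /eqP cd] _; rewrite (@cell_coord_inj _ d e) ?rd ?cd.
Qed.


(** The position is required to hold [v] for every admissible split of the ones, so the cell is
    found without knowing the split. *)
Lemma low_cell a b c T i j v : T \in tableaux a b c -> v < 2 ->
  (forall x y, x + y = b -> y <= a -> (v = 0 /\ i = 0 /\ j < a) \/
    (v = 1 /\ i = 0 /\ a <= j < a + x) \/ (v = 1 /\ i = 1 /\ j < y)) ->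
  exists e, [/\ cell_row e = i, cell_col e = j & T e = v :> nat].
Proof.
move=> /tableaux_low[x [y [xy ya p0 p1 low]]] v2 /(_ _ _ xy ya) hv.
have : j < nth 0 (val la) i.
  by case: hv => [[_ [-> ?]]|[[_ [-> ?]]|[_ [-> ?]]]]; lia.
case/cell_at => e [re ce]; exists e; split => //.
case: hv => [[-> [ri cj]]|[[-> [ri cj]]|[-> [ri cj]]]].
- by apply/(low e).1; lia.
- by apply/(low e).2; lia.
- by apply/(low e).2; lia.
Qed.

(** In this four-way form the description of zeros and ones can be handed to [lia], which then
    checks the semistandard conditions of a changed tableau. *)
Lemma low_cases (a x y v r c : nat) :
  (v = 0 <-> r = 0 /\ c < a) /\
  (v = 1 <-> (r = 0 /\ a <= c < a + x) \/ (r = 1 /\ c < y)) ->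
  [\/ [/\ v = 0, r = 0 & c < a], [/\ v = 1, r = 0 & a <= c < a + x],
      [/\ v = 1, r = 1 & c < y] |
      [/\ 1 < v, (r = 0 -> a + x <= c) & (r = 1 -> y <= c)]].
Proof.
move=> [v0 v1]; case: v v0 v1 => [|[|v]] v0 v1.
- by case: v0 => /(_ erefl)[-> ?] _; constructor 1.
- by case: v1 => /(_ erefl)[[-> ?]|[-> ?]] _; [constructor 2|constructor 3].
- by constructor 4; split => // r0; apply: contraT => h;
    [case: v0 v1 => _ v0 [_ v1]; lia|case: v1 => _ v1; lia].
Qed.

Ltac lia_cells T f g :=
  move: (nat_of_ord (T f)) (nat_of_ord (T g)) (cell_row f) (cell_col f)
    (cell_row g) (cell_col g); clear; move=> *;
  repeat match goal with
  | H : _ /\ _ |- _ => destruct H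
  | H : and3 _ _ _ |- _ => destruct H
  | H : or4 _ _ _ _ |- _ => destruct H
  end; split=> ? ?; repeat (case: ifP => ?); lia.

(** Without zeros, row 1 holds no entry 1, so row 0 starts with 1 1; the first of them becomes 0.
    The 1 left at [(0, 1)] marks the image. *)
Lemma le_02_11 c :
  #|tableaux 0 2 c| <= #|[set T in tableaux 1 1 c | entry T 0 1 1]|.
Proof.
have st T : T \in tableaux 0 2 c -> exists e, [/\ cell_row e = 0, cell_col e = 0 & T e = l1].
  move=> TA; have [||e [re ce Te]] := @low_cell _ _ _ _ 0 0 1 TA; first by lia.
    by lia.
  by exists e; split => //; apply/val_inj.
apply: (@leq_card_inj _ _ (fun T => update T 0 0 l0)) => [T TA|T T' TA TA' eqT].
  have [e [re ce Te]] := st T TA.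
  have [||e' [re' ce' Te']] := @low_cell _ _ _ _ 0 1 1 TA; [by lia|by lia|].
  have [x [y [xy y0 p0 p1 low]]] := tableaux_low TA.
  move/tableauxP: (TA) => [sT cT].
  rewrite inE; apply/andP; split; last first.
    by rewrite (entryE _ _ re' ce') ffunE re' ce' /= Te'.
  apply/tableauxP; split.
    apply/semistandardE => f g; rewrite !updateE /=.
    by move: xy y0 (low_cases (low f)) (low_cases (low g)) ((semistandardE T).1 sT f g); lia_cells T f g.
  move=> u; have := update_content T l0 u re ce; rewrite cT Te.
  by case: u => [[|[|u]] iu]; rewrite -!val_eqE /=; lia.
have [e [re ce Te]] := st T TA; have [e' [re' ce' Te']] := st T' TA'.
apply: (update_inj re ce) eqT; rewrite Te -Te'; congr (T' _).
by apply: cell_coord_inj; rewrite ?re ?ce.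
Qed.

(** A single zero allows at most one entry 1 in row 1, so row 0 starts with 0 1 1. Its middle entry
    becomes 0, and the 1 at [(0, 2)] marks the image. *)
Lemma le_13_22 c :
  #|tableaux 1 3 c| <= #|[set T in tableaux 2 2 c | entry T 0 2 1]|.
Proof.
have st T : T \in tableaux 1 3 c -> exists e, [/\ cell_row e = 0, cell_col e = 1 & T e = l1].
  move=> TA; have [||e [re ce Te]] := @low_cell _ _ _ _ 0 1 1 TA; first by lia.
    by lia.
  by exists e; split => //; apply/val_inj.
apply: (@leq_card_inj _ _ (fun T => update T 0 1 l0)) => [T TA|T T' TA TA' eqT].
  have [e [re ce Te]] := st T TA.
  have [||e' [re' ce' Te']] := @low_cell _ _ _ _ 0 2 1 TA; [by lia|by lia|].
  have [x [y [xy y0 p0 p1 low]]] := tableaux_low TA.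
  move/tableauxP: (TA) => [sT cT].
  rewrite inE; apply/andP; split; last first.
    by rewrite (entryE _ _ re' ce') ffunE re' ce' /= Te'.
  apply/tableauxP; split.
    apply/semistandardE => f g; rewrite !updateE /=.
    by move: xy y0 (low_cases (low f)) (low_cases (low g)) ((semistandardE T).1 sT f g); lia_cells T f g.
  move=> u; have := update_content T l0 u re ce; rewrite cT Te.
  by case: u => [[|[|u]] iu]; rewrite -!val_eqE /=; lia.
have [e [re ce Te]] := st T TA; have [e' [re' ce' Te']] := st T' TA'.
apply: (update_inj re ce) eqT; rewrite Te -Te'; congr (T' _).
by apply: cell_coord_inj; rewrite ?re ?ce.
Qed.

(** Row 0 starts with 0 1 1 and row 1 holds no 1, so replacing the corner 0 by 1 keeps the first
    column strict. *)
Lemma le_12_03 c :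
  #|[set T in tableaux 1 2 c | entry T 0 2 1]| <= #|tableaux 0 3 c|.
Proof.
have st T : T \in tableaux 1 2 c -> exists e, [/\ cell_row e = 0, cell_col e = 0 & T e = l0].
  move=> TA; have [||e [re ce Te]] := @low_cell _ _ _ _ 0 0 0 TA; first by lia.
    by lia.
  by exists e; split => //; apply/val_inj.
apply: (@leq_card_inj _ _ (fun T => update T 0 0 l1)) => [T|T T'].
  rewrite inE => /andP[TA /entryP[e' [re' ce' Te']]].
  have [e [re ce Te]] := st T TA.
  have [x [y [xy y0 p0 p1 low]]] := tableaux_low TA.
  move/tableauxP: (TA) => [sT cT].
  have := (low e').2; rewrite Te' re' ce' => -[/(_ erefl) x2 _].
  apply/tableauxP; split.
    apply/semistandardE => f g; rewrite !updateE /=.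
    by move: x2 xy y0 (low_cases (low f)) (low_cases (low g)) ((semistandardE T).1 sT f g); lia_cells T f g.
  move=> u; have := update_content T l1 u re ce; rewrite cT Te.
  by case: u => [[|[|u]] iu]; rewrite -!val_eqE /=; lia.
rewrite inE => /andP[TA _]; rewrite inE => /andP[TA' _] eqT.
have [e [re ce Te]] := st T TA; have [e' [re' ce' Te']] := st T' TA'.
apply: (update_inj re ce) eqT; rewrite Te -Te'; congr (T' _).
by apply: cell_coord_inj; rewrite ?re ?ce.
Qed.

(** Two ones in row 0 would reach [(0, 2)], and row 1 has space for only one, so the corner reads 0
    1 over 1. *)
Lemma low_entries_12 c T : T \in tableaux 1 2 c -> ~~ entry T 0 2 1 ->
  [/\ exists e, [/\ cell_row e = 0, cell_col e = 0 & T e = l0],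
      exists e, [/\ cell_row e = 0, cell_col e = 1 & T e = l1],
      exists e, [/\ cell_row e = 1, cell_col e = 0 & T e = l1] &
      forall e, (T e = 0 :> nat <-> cell_row e = 0 /\ cell_col e < 1) /\
        (T e = 1 :> nat <-> (cell_row e = 0 /\ 1 <= cell_col e < 1 + 1) \/
                            (cell_row e = 1 /\ cell_col e < 1))].
Proof.
move=> TA nT; have [x [y [xy y0 p0 p1 low]]] := tableaux_low TA.
have x1 : x = 1.
  case: (leqP x 1) => [|x2]; first by lia.
  have [e [re ce]] := @cell_at la 0 2 ltac:(lia).
  by case/negP: nT; rewrite (entryE T 1 re ce); apply/eqP/(low e).2; lia.
have y1 : y = 1 by lia.
subst x y; split.
- have [e [re ce]] := @cell_at la 0 0 ltac:(lia).
  by exists e; split => //; apply/val_inj/(low e).1; lia.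
- have [e [re ce]] := @cell_at la 0 1 ltac:(lia).
  by exists e; split => //; apply/val_inj/(low e).2; lia.
- have [e [re ce]] := @cell_at la 1 0 ltac:(lia).
  by exists e; split => //; apply/val_inj/(low e).2; lia.
- exact: low.
Qed.

(** The corner 0 1 over 1 2 becomes 0 0 over 1 1. *)
Lemma le_12_22 c :
  #|[set T in tableaux 1 2 c.+1 | ~~ entry T 0 2 1 & entry T 1 1 2]|
  <= #|[set T in tableaux 2 2 c | entry T 1 1 1]|.
Proof.
apply: (@leq_card_inj _ _ (fun T => update (update T 0 1 l0) 1 1 l1)) => [T|T T'].
  rewrite inE => /and3P[TA nT /entryP[g [rg cg Tg]]].
  have [_ [e [re ce Te]] _ low] := low_entries_12 TA nT.
  move/tableauxP: (TA) => [sT cT].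
  rewrite inE; apply/andP; split; last first.
    by rewrite (entryE _ _ rg cg) ffunE rg cg.
  apply/tableauxP; split.
    apply/semistandardE => f h; rewrite !updateE /=.
    by move: (low_cases (low f)) (low_cases (low h)) ((semistandardE T).1 sT f h); lia_cells T f h.
  move=> u; have := update_content (update T 0 1 l0) l1 u rg cg.
  have := update_content T l0 u re ce; rewrite cT Te ffunE rg cg /=.
  have -> : T g = l2 by apply: ord_inj.
  by case: u => [[|[|[|u]]] iu]; rewrite -!val_eqE /=; lia.
rewrite inE => /and3P[TA nT /entryP[g [rg cg Tg]]].
rewrite inE => /and3P[TA' nT' /entryP[g' [rg' cg' Tg']]] eqT.
have [_ [e [re ce Te]] _ _] := low_entries_12 TA nT.
have [_ [e' [re' ce' Te']] _ _] := low_entries_12 TA' nT'.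
have ee : e' = e by apply: cell_coord_inj; rewrite ?re ?ce.
have gg : g' = g by apply: cell_coord_inj; rewrite ?rg ?cg.
subst e' g'; apply: (update_inj re ce); first by rewrite Te.
by apply: (update_inj rg cg) eqT; apply: ord_inj; rewrite !updateE rg cg /= Tg.
Qed.

(** The corner 0 1 over 1 becomes 0 2 over 1. The column below the new 2 stays strict because
    [(1, 1)] does not hold 2. *)
Lemma le_12_11 c :
  #|[set T in tableaux 1 2 c | ~~ entry T 0 2 1 & ~~ entry T 1 1 2]|
  <= #|[set T in tableaux 1 1 c.+1 | entry T 1 0 1]|.
Proof.
apply: (@leq_card_inj _ _ (fun T => update T 0 1 l2)) => [T|T T'].
  rewrite inE => /and3P[TA nT ng].
  have [_ [e [re ce Te]] [g [rg cg Tg]] low] := low_entries_12 TA nT.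
  move/tableauxP: (TA) => [sT cT].
  rewrite inE; apply/andP; split; last first.
    by rewrite (entryE _ _ rg cg) ffunE rg cg /= Tg.
  (* In row 1 the entry is neither 1 nor 2; in row 2 it exceeds an entry that is at least 2; further
     down the row index is bound enough. *)
  have below f : cell_col f = 1 -> 0 < cell_row f -> 2 < T f.
    case rf: (cell_row f) => [//|[|[|r]]] cf _.
    - have nf : T f <> 2 :> nat by apply/eqP; rewrite -(entryE T 2 rf cf).
      by case: (low_cases (low f)) => -[? ? ?]; lia.
    - have [d [rd cd lt]] := ssyt_above sT rf.
      have nd : T d <> 2 :> nat by apply/eqP; rewrite -(entryE T 2 rd (etrans cd cf)).
      apply: leq_ltn_trans lt; move: (low_cases (low d)); rewrite rd cd cf.
      by case=> [[]|[]|[]|[]].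
    - by apply: leq_trans (ssyt_ge_row sT f); rewrite rf.
  apply/tableauxP; split.
    apply/semistandardE => f h; rewrite !updateE /=.
    by move: (below f) (below h) (low_cases (low f)) (low_cases (low h)) ((semistandardE T).1 sT f h); lia_cells T f h.
  move=> u; have := update_content T l2 u re ce; rewrite cT Te.
  by case: u => [[|[|[|u]]] iu]; rewrite -!val_eqE /=; lia.
rewrite inE => /and3P[TA nT _]; rewrite inE => /and3P[TA' nT' _] eqT.
have [_ [e [re ce Te]] _ _] := low_entries_12 TA nT.
have [_ [e' [re' ce' Te']] _ _] := low_entries_12 TA' nT'.
apply: (update_inj re ce) eqT; rewrite Te -Te'; congr (T' _).
by apply: cell_coord_inj; rewrite ?re ?ce.
Qed.

Lemma card_disjoint_sub (A : {set tableau}) (p q : pred tableau) :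
  (forall T, T \in A -> p T -> q T -> False) ->
  #|[set T in A | p T]| + #|[set T in A | q T]| <= #|A|.
Proof.
move=> dpq; rewrite -cardsUI (_ : _ :&: _ = set0) ?cards0 ?addn0; last first.
  apply/setP => T; rewrite in_set0; apply/negP.
  rewrite in_setI => /andP[]; rewrite inE => /andP[TA pT]; rewrite inE => /andP[_].
  exact: dpq TA pT.
apply: subset_leq_card; apply/subsetP => T.
by rewrite in_setU => /orP[]; rewrite inE => /andP[].
Qed.

(** The entries at [(0, 2)] and [(1, 1)] split the tableaux of content [1 2 c.+1] into three
    classes, one for each content on the right. Two of these targets receive another family too. The
    images are disjoint: with two ones, a 1 at [(1, 1)] puts both in row 1 and excludes one at
    [(0, 2)]; a single 1 cannot be at both [(0, 1)] and [(1, 0)]. *)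
Lemma card_tableaux_le c :
  #|tableaux 1 2 c.+1| + #|tableaux 1 3 c| + #|tableaux 0 2 c.+2|
  <= #|tableaux 2 2 c| + #|tableaux 1 1 c.+2| + #|tableaux 0 3 c.+1|.
Proof.
have d22 : #|[set T in tableaux 2 2 c | entry T 0 2 1]| +
    #|[set T in tableaux 2 2 c | entry T 1 1 1]| <= #|tableaux 2 2 c|.
  apply: card_disjoint_sub => T TA /entryP[e [re ce Te]] /entryP[d [rd cd Td]].
  have [x [y [xy y0 p0 p1 low]]] := tableaux_low TA.
  by have := (low e).2.1 Te; have := (low d).2.1 Td; lia.
have d11 : #|[set T in tableaux 1 1 c.+2 | entry T 0 1 1]| +
    #|[set T in tableaux 1 1 c.+2 | entry T 1 0 1]| <= #|tableaux 1 1 c.+2|.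
  apply: card_disjoint_sub => T TA /entryP[e [re ce Te]] /entryP[d [rd cd Td]].
  have [x [y [xy y0 p0 p1 low]]] := tableaux_low TA.
  by have := (low e).2.1 Te; have := (low d).2.1 Td; lia.
have split12 : #|tableaux 1 2 c.+1| = #|[set T in tableaux 1 2 c.+1 | entry T 0 2 1]| +
   #|[set T in tableaux 1 2 c.+1 | ~~ entry T 0 2 1 & entry T 1 1 2]| +
   #|[set T in tableaux 1 2 c.+1 | ~~ entry T 0 2 1 & ~~ entry T 1 1 2]|.
  rewrite -(cardsID [set T | entry T 0 2 1]).
  rewrite -addnA; congr (_ + _).
    by apply: eq_card => T; rewrite [in RHS]inE in_setI [T \in [set _ | _]]inE.
  rewrite -(cardsID [set T | entry T 1 1 2]); congr (_ + _).
    by apply: eq_card => T; rewrite [in RHS]inE in_setI in_setD ![T \in [set _ | _]]inE -andbA andbCA.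
  apply: eq_card => T; rewrite [in RHS]inE !in_setD ![T \in [set _ | _]]inE.
  by rewrite andbA andbC [~~ _ && ~~ _]andbC.
move: (le_02_11 c.+2) (le_13_22 c) (le_12_03 c.+1) (le_12_22 c) (le_12_11 c.+1) d22 d11 split12.
by lia.
Qed.

End CrossingInjection.

(** * Colourings of the grid by big and small colours *)

Section Grid.
Variables N k : nat.
Hypothesis N_gt0 : 0 < N.
Local Notation X := ('I_(N + k).+1 * 'I_N.+1)%type.
Local Notation col := {ffun X -> 'I_N.+3}.

Definition level (x : X) : nat := x.1 + x.2.

Definition grid_cmp (x y : X) : bool :=
  (x.1 <= y.1) && (x.2 <= y.2) || (y.1 <= x.1) && (y.2 <= x.2).

(* The big colours are encoded as [i.+3] for [i < N], the small ones as 0, 1, 2. *)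
Definition valid (f : col) : Prop :=
  (forall x y : X, f x = f y -> grid_cmp x y) /\
  (forall i, i < N -> #|[set x : X | f x == i.+3 :> nat]| = 2 * N + k + 1 - 2 * i).

Definition grid_cell (a j : nat) : X := (inord a, inord j).

Lemma grid_cellK a j : a <= N + k -> j <= N -> (grid_cell a j).1 = a :> nat /\ (grid_cell a j).2 = j :> nat.
Proof. by move=> ha hj; rewrite /grid_cell /= !inordK. Qed.

Lemma grid_cell_eq (x y : X) : x.1 = y.1 :> nat -> x.2 = y.2 :> nat -> x = y.
Proof. by case: x y => [a j] [b i] /= /val_inj -> /val_inj ->. Qed.

Lemma row_le (x : X) : x.2 <= N.
Proof. by rewrite -ltnS. Qed.

Lemma column_le (x : X) : x.1 <= N + k.
Proof. by rewrite -ltnS. Qed.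

(* The number of grid cells [x] with [level x = l]. *)
Definition level_size (l : nat) : nat := minn (minn l.+1 (2 * N + k + 1 - l)) N.+1.

(** * The levels and rows that the colours of a valid colouring occupy *)

Section Valid.
Variable f : col.
Hypothesis vf : valid f.

Lemma chain_level_inj (x y : X) : f x = f y -> level x = level y -> x = y.
Proof.
move=> /vf.1; rewrite /grid_cmp /level => h l.
by apply: grid_cell_eq; lia.
Qed.

Lemma chain_mono (x y : X) : f x = f y -> level x <= level y -> x.1 <= y.1 /\ x.2 <= y.2.
Proof. by move=> /vf.1; rewrite /grid_cmp /level => h l; lia. Qed.

(** Pigeonhole on rows: each colour picks a cell of the level, cells of one level differ in their
    rows, and these rows lie in a window of [level_size l] values starting at the truncated
    difference [l - (N + k)]. *)
Lemma level_colors_le l (s : seq nat) : uniq s ->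
  (forall c : nat, c \in s -> exists x : X, level x = l /\ f x = c :> nat) ->
  size s <= level_size l.
Proof.
move=> us hs.
have rowX (c : nat) : c \in s -> exists j : nat, (j \in iota (l - (N + k)) (level_size l)) &&
    [exists x : X, [&& level x == l, x.2 == j :> nat & f x == c :> nat]].
  move=> /hs[x [lx fx]]; exists (x.2 : nat); apply/andP; split.
    rewrite mem_iota /level_size; have := row_le x; have := column_le x.
    by move: lx; rewrite /level; lia.
  by apply/existsP; exists x; rewrite lx fx !eqxx.
(* Matching on [idP] gives the choice access to the membership proof; the value 0 outside [s] is a
   mere default. *)
pose r (c : nat) : nat := if @idP (c \in s) is ReflectT h then xchoose (rowX c h) else 0.
have rP (c : nat) : c \in s -> (r c \in iota (l - (N + k)) (level_size l)) /\
    exists x : X, [/\ level x = l, x.2 = r c :> nat & f x = c :> nat].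
  move=> cs; rewrite /r; case: {-}_ / idP => // h.
  have /andP[h1 /existsP[x /and3P[/eqP ? /eqP ? /eqP ?]]] := xchooseP (rowX c h).
  by split=> //; exists x.
rewrite -(size_map r) -[leqRHS](size_iota (l - (N + k))).
apply: uniq_leq_size => [|j /mapP[c cs ->]]; last by case: (rP c cs).
rewrite map_inj_in_uniq // => c d cs ds rE.
have [_ [x [lx x2 <-]]] := rP c cs; have [_ [y [ly y2 <-]]] := rP d ds.
have xy : x = y by apply: grid_cell_eq; move: lx ly; rewrite /level; lia.
by rewrite xy.
Qed.

(** The first [level_size l] big colours already fill the level, so one more colour would break the
    pigeonhole bound. *)
Lemma crowded_level l (x : X) : level x = l ->
  (forall i, i < level_size l -> i < N -> exists y : X, level y = l /\ f y = i.+3 :> nat) ->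
  level_size l <= N -> exists i, i < level_size l /\ f x = i.+3 :> nat.
Proof.
move=> lx hl lN.
pose s := [seq i.+3 | i <- iota 0 (level_size l)].
have [/mapP[i]|fs] := boolP ((f x : nat) \in s).
  by rewrite mem_iota => il fi; exists i; rewrite fi; split => //; lia.
suff : size ((f x : nat) :: s) <= level_size l by rewrite /= size_map size_iota ltnn.
apply: level_colors_le.
  by rewrite /= fs /= map_inj_uniq ?iota_uniq // => i j [].
move=> c; rewrite inE => /orP[/eqP ->|/mapP[i]]; first by exists x.
by rewrite mem_iota => il ->; apply: hl; lia.
Qed.

(** Strong induction: a level outside the range for [i] has at most [i] cells, all taken by earlier
    big colours. The class has as many cells as there are levels left, and at most one in each, so
    it meets every one of them. *)
Lemma big_level i : i < N ->
  (forall x : X, f x = i.+3 :> nat -> i <= level x <= 2 * N + k - i) /\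
  (forall l, i <= l <= 2 * N + k - i -> exists x : X, level x = l /\ f x = i.+3 :> nat).
Proof.
elim/ltn_ind: i => i IH iN.
have rng (x : X) : f x = i.+3 :> nat -> i <= level x <= 2 * N + k - i.
  move=> fx; case: (boolP (i <= level x <= _)) => // nl.
  have lsi : level_size (level x) <= i by rewrite /level_size; lia.
  have [i' i'l i'N||i' [i'l fx']] := @crowded_level (level x) x erefl.
  - have [_ h] := IH i' (leq_trans i'l lsi) i'N.
    by apply: h; move: i'l; rewrite /level_size; lia.
  - by lia.
  - by move: fx'; rewrite fx; lia.
split=> // l hl.
pose C := enum [set x : X | f x == i.+3 :> nat].
have Cf (x : X) : x \in C -> f x = i.+3 :> nat by rewrite mem_enum inE => /eqP.
have uC : uniq (map level C).
  rewrite map_inj_in_uniq ?enum_uniq // => x y /Cf fx /Cf fy; apply: chain_level_inj.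
  by apply: ord_inj; rewrite fx fy.
have sC : {subset map level C <= iota i (2 * N + k + 1 - 2 * i)}.
  by move=> _ /mapP[x /Cf /rng h ->]; rewrite mem_iota; lia.
have [|_ eqC] := uniq_min_size uC sC.
  by rewrite size_iota size_map -cardE vf.2.
have : l \in map level C by rewrite eqC mem_iota; lia.
by case/mapP => x /Cf fx ->; exists x.
Qed.

Lemma big_at i l : i < N -> N.-1 <= l <= N + k + 1 ->
  exists x : X, level x = l /\ f x = i.+3 :> nat.
Proof. by move=> iN hl; apply: (big_level iN).2; lia. Qed.

(** The other levels have at most [N] cells, which the big colours fill. *)
Lemma small_level (x : X) : f x < 3 -> N <= level x <= N + k.
Proof.
move=> fx; case: (boolP (_ <= _ <= _)) => // nl.
have lsN : level_size (level x) <= N by rewrite /level_size; lia.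
have [i il iN|//|i [_ fxi]] := @crowded_level (level x) x erefl.
  by apply: (big_level iN).2; move: il; rewrite /level_size; lia.
by rewrite fxi in fx.
Qed.

(** Such a level has [N + 1] cells, one more than there are big colours. *)
Lemma small_at l : N <= l <= N + k -> exists x : X, level x = l /\ f x < 3.
Proof.
move=> hl; pose x j : X := grid_cell (l - j) j.
have xl j : j <= N -> level (x j) = l /\ (x j).2 = j :> nat.
  by move=> jN; have [e1 e2] := @grid_cellK (l - j) j ltac:(lia) jN; rewrite /level e1 e2; lia.
have [/existsP[j fj]|nj] := boolP [exists j : 'I_N.+1, f (x j) < 3].
  by exists (x j); split => //; apply: (xl j _).1; rewrite -ltnS.
suff : size (map (fun j => f (x j) : nat) (iota 0 N.+1)) <= size (iota 3 N).
  by rewrite size_map !size_iota ltnn.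
apply: uniq_leq_size => [|c /mapP[j]].
  rewrite map_inj_in_uniq ?iota_uniq // => i j; rewrite !mem_iota => hi hj.
  have [li ri] := @xl i ltac:(lia); have [lj rj] := @xl j ltac:(lia).
  move=> /ord_inj/chain_level_inj; rewrite li lj => /(_ erefl) xx.
  by rewrite -ri xx rj.
rewrite mem_iota => jN ->; rewrite mem_iota; have := ltn_ord (f (x j)).
move/existsPn: nj => /(_ (Ordinal (jN : j < N.+1))) /=; lia.
Qed.


(** Level [N - 1] has [N] cells, all of them big, so its rows serve as names for the big colours, in
    whatever order a colouring places them. *)
Definition base (s : nat) : X := grid_cell (N.-1 - s) s.

Lemma base_coord s : s < N -> (base s).1 = N.-1 - s :> nat /\ (base s).2 = s :> nat.
Proof. by move=> sN; apply: grid_cellK; lia. Qed.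

Lemma level_base s : s < N -> level (base s) = N.-1.
Proof. by move=> sN; have [e1 e2] := base_coord sN; rewrite /level e1 e2; lia. Qed.

Lemma base_big s : s < N -> exists2 i, i < N & f (base s) = i.+3 :> nat.
Proof.
move=> sN; have fb : ~~ (f (base s) < 3).
  by apply/negP => /small_level; rewrite level_base //; lia.
by exists (f (base s) - 3); have := ltn_ord (f (base s)); lia.
Qed.

Lemma base_at s l : s < N -> N.-1 <= l <= N + k + 1 ->
  exists x : X, level x = l /\ f x = f (base s).
Proof.
move=> sN hl; have [i iN fi] := base_big sN.
have [x [lx fx]] := big_at iN hl.
by exists x; split => //; apply: ord_inj; rewrite fx fi.
Qed.

Lemma base_inj s t : s < N -> t < N -> f (base s) = f (base t) -> s = t.
Proof.
move=> sN tN /chain_level_inj; rewrite !level_base // => /(_ erefl) st.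
by rewrite -(base_coord sN).2 st (base_coord tN).2.
Qed.

(* Between consecutive levels a chain moves up by at most one row, so two
   chains present at both levels cannot cross. *)
Lemma base_order s t l (x y : X) : s < t < N -> N.-1 <= l <= N + k + 1 ->
  level x = l -> level y = l -> f x = f (base s) -> f y = f (base t) -> x.2 < y.2.
Proof.
move=> /andP[st tN]; have sN := ltn_trans st tN.
elim: l x y => [|l IH] x y hl lx ly fx fy.
  have /(_ _ _ fx) := chain_level_inj; have /(_ _ _ fy) := chain_level_inj.
  rewrite !level_base // ly lx => yE xE.
  rewrite (yE ltac:(lia)) (xE ltac:(lia)).
  by rewrite (base_coord sN).2 (base_coord tN).2.
have [hl'|hl'] := leqP N l.+1; last first.
  have /(_ _ _ fx) := chain_level_inj; have /(_ _ _ fy) := chain_level_inj.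
  rewrite !level_base // ly lx => yE xE.
  rewrite (yE ltac:(lia)) (xE ltac:(lia)).
  by rewrite (base_coord sN).2 (base_coord tN).2.
have [x' [lx' fx']] := @base_at s l sN ltac:(lia).
have [y' [ly' fy']] := @base_at t l tN ltac:(lia).
have xy' := IH x' y' ltac:(lia) lx' ly' fx' fy'.
have := @chain_mono x' x; rewrite fx fx' lx lx' => /(_ erefl (leqnSn _)) [h1 h2].
have := @chain_mono y' y; rewrite fy fy' ly ly' => /(_ erefl (leqnSn _)) [h3 h4].
have nxy : x <> y.
  by move=> xy; move: fx; rewrite xy fy => /(base_inj tN sN); lia.
have nr : x.2 <> y.2 :> nat.
  by move=> xy; apply: nxy; apply: grid_cell_eq => //; move: lx ly; rewrite /level; lia.
by move: lx ly lx' ly'; rewrite /level; lia.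
Qed.

(** Once the empty row [p] is skipped, the rows of the [N] big colours form a strictly increasing
    self-map of [N] values, hence the identity; [bump p] puts the gap back. *)
Lemma base_rank l p : N.-1 <= l <= N + k + 1 -> p <= N ->
  (forall s (x : X), s < N -> level x = l -> f x = f (base s) -> x.2 <> p :> nat) ->
  forall s (x : X), s < N -> level x = l -> f x = f (base s) -> x.2 = bump p s :> nat.
Proof.
move=> hl pN np.
have /fin_all_exists[g gP] (s : 'I_N) :
  exists x : X, level x = l /\ f x = f (base s) by apply: base_at.
pose h (s : 'I_N) := unbump p (g s).2.
have gne (s : 'I_N) : (g s).2 <> p :> nat by have [? ?] := gP s; apply: (np s).
have hlt (s t : 'I_N) : s < t -> h s < h t.
  move=> st; have [? ?] := gP s; have [? ?] := gP t.
  have : (g s).2 < (g t).2 by apply: (@base_order s t l) => //; rewrite st ltn_ord.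
  by have := gne s; have := gne t; rewrite /h /unbump; lia.
have hN (s : 'I_N) : h s < N.
  by have := gne s; have := row_le (g s); rewrite /h /unbump; lia.
(* Two inductions, from the first and from the last colour, squeeze [h s] to [s]. *)
have hge m : forall s : 'I_N, s = m :> nat -> m <= h s.
  elim: m => // m IH s sm; have mN : m < N by rewrite -ltnS; move: (ltn_ord s); lia.
  have := IH (Ordinal mN) erefl; have := @hlt (Ordinal mN) s; rewrite sm /=; lia.
have hle m : forall s : 'I_N, N.-1 - s = m :> nat -> m + h s < N.
  elim: m => [|m IH] s sm; first by have := hN s.
  have mN : s.+1 < N by lia.
  have := IH (Ordinal mN); have := @hlt s (Ordinal mN); rewrite /=; lia.
move=> s x sN lx fx.
have [ls fs] := gP (Ordinal sN).
have -> : x = g (Ordinal sN) by apply: chain_level_inj; rewrite ?fx ?fs ?lx ?ls.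
have := hge _ (Ordinal sN) erefl; have := hle _ (Ordinal sN) erefl.
by have := gne (Ordinal sN); rewrite /h /unbump /bump /=; lia.
Qed.

Lemma middle_rank (y : X) s (x : X) : f y < 3 -> s < N -> level x = level y ->
  f x = f (base s) -> x.2 = bump y.2 s :> nat.
Proof.
move=> fy sN lxy fx; have := small_level fy => ly.
apply: (@base_rank (level y)) fx => //; [by lia | exact: row_le |].
move=> t z tN lz fz zy; have [i iN fb] := base_big tN.
have zy' : z = y by apply: grid_cell_eq => //; move: lz; rewrite /level; lia.
by move: fy; rewrite -zy' fz fb.
Qed.

(** The big colour of the rank in question has a cell on this level, and [middle_rank] places that
    cell at [x]. *)
Lemma middle_color (x y : X) : f y < 3 -> level x = level y -> x <> y ->
  f x = f (base (unbump y.2 x.2)).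
Proof.
move=> fy lxy nxy; have ly := small_level fy.
have nr : x.2 <> y.2 :> nat.
  by move=> h; apply: nxy; apply: grid_cell_eq => //; move: lxy; rewrite /level; lia.
have uN : unbump y.2 x.2 < N.
  by have := row_le x; have := row_le y; rewrite /unbump; lia.
have [z [lz fz]] := @base_at _ (level y) uN ltac:(lia).
have zr := middle_rank fy uN lz fz.
rewrite -fz; congr (f _); apply: grid_cell_eq.
  move: zr lz lxy; rewrite /level /bump /unbump; lia.
by move: zr; rewrite /bump /unbump; lia.
Qed.

Lemma top_rank s (x : X) : s < N -> level x = N + k + 1 -> f x = f (base s) ->
  x.2 = s.+1 :> nat.
Proof.
(* Row 0 of this level would need column [N + k + 1], so the gap is at [p = 0]. *)
move=> sN lx fx; rewrite (@base_rank (N + k + 1) 0 _ _ _ s x) //; first by lia.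
by move=> t z _ lz _ z0; move: lz; rewrite /level; have := column_le z; lia.
Qed.

End Valid.

Lemma valid_of_levels (g : col) :
  (forall x y : X, g x = g y -> grid_cmp x y) ->
  (forall i, i < N ->
    (forall x : X, g x = i.+3 :> nat -> i <= level x <= 2 * N + k - i) /\
    (forall l, i <= l <= 2 * N + k - i -> exists x : X, level x = l /\ g x = i.+3 :> nat)) ->
  valid g.
Proof.
move=> chain lev; split=> // i iN; have [l1 l2] := lev i iN.
rewrite cardE -(size_map level) -[RHS](size_iota i).
have Cg (x : X) : x \in enum [set x : X | g x == i.+3 :> nat] -> g x = i.+3 :> nat.
  by rewrite mem_enum inE => /eqP.
apply/perm_size/uniq_perm; rewrite ?iota_uniq //.
  rewrite map_inj_in_uniq ?enum_uniq // => x y /Cg gx /Cg gy lxy.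
  have /chain : g x = g y by apply: ord_inj; rewrite gx gy.
  by move: lxy; rewrite /level /grid_cmp => ? ?; apply: grid_cell_eq; lia.
move=> l; apply/mapP/idP => [[x /Cg /l1 hx ->]|].
  by rewrite mem_iota; lia.
rewrite mem_iota => hl; have [x [<- gx]] := l2 l ltac:(lia).
by exists x => //; rewrite mem_enum inE gx.
Qed.

Lemma exists_valid : exists g : col, valid g.
Proof.
(* The chain of [i] is a hook: along row [i] up to column [N + k - i], then up that column. The
   remaining cells lie in row [N] and get the small colour 0. *)
pose h (x : X) := minn x.2 (N + k - x.1).
pose g : col := [ffun x : X => inord (if h x < N then (h x).+3 else 0)].
have gE (x : X) : g x = (if h x < N then (h x).+3 else 0) :> nat.
  by rewrite ffunE inordK //; case: ifP; lia.
exists g; apply: valid_of_levels => [x y gxy|i iN].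
  have : g x = g y :> nat by rewrite gxy.
  rewrite !gE /h /grid_cmp; have := row_le x; have := row_le y.
  have := column_le x; have := column_le y.
  by case: ifP => ?; case: ifP => ? //; lia.
split=> [x|l hl].
  rewrite gE /level /h; have := row_le x; have := column_le x.
  by case: ifP => ?; lia.
have [ll|ll] := leqP l (N + k).
  have [e1 e2] := @grid_cellK (l - i) i ltac:(lia) ltac:(lia).
  exists (grid_cell (l - i) i); rewrite gE /level /h e1 e2.
  by split; first lia; case: ifP; lia.
have [e1 e2] := @grid_cellK (N + k - i) (l - (N + k - i)) ltac:(lia) ltac:(lia).
exists (grid_cell (N + k - i) (l - (N + k - i))); rewrite gE /level /h e1 e2.
by split; first lia; case: ifP; lia.
Qed.


(** * Encoding the small cells by words *)

Local Notation word := {ffun 'I_k.+1 -> 'I_N.+1 * 'I_3}.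

Implicit Types (f g : col) (q : word) (x y : X).

(** Letter [r] stands for the row and the colour of the small cell on level [N + r]. *)
Definition valid_word (q : word) : Prop :=
  (forall r r' : 'I_k.+1, r <= r' -> (q r').1 <= (q r).1) /\
  (forall r r' : 'I_k.+1, (q r).2 = (q r').2 -> (q r).1 = (q r').1).

Definition middle (x : X) : bool := N <= level x <= N + k.

Definition slot (x : X) : 'I_k.+1 := inord (level x - N).

Lemma slotE x : middle x -> slot x = level x - N :> nat.
Proof. by rewrite /middle => h; rewrite /slot inordK; lia. Qed.

(* In the middle level [N + r] the big colours keep the order they have at level
   [N.-1], which has no other cells. *)
Definition refill (f : col) (q : word) : col :=
  [ffun x => if middle x then
     (if x.2 == (q (slot x)).1 then inord (q (slot x)).2
      else f (base (unbump (q (slot x)).1 x.2)))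
   else f x].

Lemma refill_out f q x : ~~ middle x -> refill f q x = f x.
Proof. by move=> /negbTE h; rewrite ffunE h. Qed.

Lemma refill_small f q x : middle x -> x.2 = (q (slot x)).1 ->
  refill f q x = (q (slot x)).2 :> nat.
Proof.
move=> h e; rewrite ffunE h e eqxx inordK //.
by apply: leq_trans (ltn_ord _) _; rewrite !ltnS.
Qed.

Lemma unbump_lt (p : 'I_N.+1) (x : X) : x.2 <> p -> unbump p x.2 < N.
Proof.
move=> xp; have : x.2 <> p :> nat by move/ord_inj.
by have := row_le x; have := ltn_ord p; rewrite /unbump; lia.
Qed.

Lemma refill_big f q x : middle x -> x.2 <> (q (slot x)).1 ->
  refill f q x = f (base (unbump (q (slot x)).1 x.2)).
Proof. by move=> h /eqP/negbTE e; rewrite ffunE h e. Qed.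

Lemma base_out s : s < N -> ~~ middle (base s).
Proof. by move=> sN; rewrite /middle level_base //; lia. Qed.

Lemma refill_base f q s : s < N -> refill f q (base s) = f (base s).
Proof. by move=> sN; rewrite refill_out // base_out. Qed.

(** [refill] reads [f] only outside the middle levels, so an earlier refill leaves no trace. *)
Lemma refill_rep f q q' : refill (refill f q) q' = refill f q'.
Proof.
apply/ffunP => x; rewrite ffunE [RHS]ffunE; case: ifP => mx; last by rewrite refill_out ?mx.
by case: ifP => // /eqP xq; rewrite refill_base // unbump_lt.
Qed.

Lemma refill_lt3 f q x : valid f -> (refill f q x < 3) = middle x && (x.2 == (q (slot x)).1).
Proof.
move=> vf; case: (boolP (middle x)) => mx /=; last first.
  rewrite refill_out //; apply: contraNF mx => /(small_level vf).
  by [].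
case: eqP => [e|e]; first by rewrite refill_small // ltn_ord.
rewrite refill_big //; have [i _ ->] := base_big vf (unbump_lt e).
by [].
Qed.

Lemma word_cell (q : word) (r : 'I_k.+1) :
  exists x : X, [/\ middle x, slot x = r & x.2 = (q r).1].
Proof.
have pN : (q r).1 <= N by rewrite -ltnS.
have rk : r <= k by rewrite -ltnS.
have [e1 e2] := @grid_cellK (N + r - (q r).1) (q r).1 ltac:(lia) ltac:(lia).
have lx : level (grid_cell (N + r - (q r).1) (q r).1) = N + r by rewrite /level e1 e2; lia.
have mx : middle (grid_cell (N + r - (q r).1) (q r).1) by rewrite /middle lx; lia.
exists (grid_cell (N + r - (q r).1) (q r).1); split => //.
  by apply: ord_inj; rewrite slotE // lx; lia.
exact: ord_inj.
Qed.

Lemma slot_row_inj x y : middle x -> middle y -> slot x = slot y ->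
  x.2 = y.2 -> x = y.
Proof.
move=> mx my sxy xy; have := slotE mx; have := slotE my; rewrite sxy.
move: mx my; rewrite /middle /level xy => mx my sx sy; apply: grid_cell_eq; last by rewrite xy.
by lia.
Qed.


(** Small cells of one colour share a row. For a big colour, a cell below the middle levels is
    compared through level [N - 1], and one above them through level [N + k + 1], where the gap is
    row 0. Between two middle levels the gap descends, so the row of the colour stays or rises by
    one, which leaves the column weakly increasing. *)
Lemma refill_chain_le f q x y : valid f -> valid_word q -> refill f q x = refill f q y ->
  level x <= level y -> grid_cmp x y.
Proof.
move=> vf [qd qc] rxy lxy.
have [sx|bx] := boolP (refill f q x < 3).
  have sy : refill f q y < 3 by rewrite -rxy.
  move: (sx) (sy); rewrite !refill_lt3 // => /andP[mx /eqP ex] /andP[my /eqP ey].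
  have rr : (q (slot x)).2 = (q (slot y)).2.
    by apply: ord_inj; rewrite -(refill_small f mx ex) -(refill_small f my ey) rxy.
  have xy : x.2 = y.2 :> nat by rewrite ex ey (qc _ _ rr).
  by move: lxy; rewrite /level /grid_cmp xy; lia.
have by' : ~~ (refill f q y < 3) by rewrite -rxy.
move: bx by'; rewrite !refill_lt3 //.
have [mx|mx] := boolP (middle x) => /=; last first.
  have [my|my] := boolP (middle y) => /=; last first.
    by move=> _ _; move: rxy; rewrite !refill_out // => /vf.1.
  move=> _ /eqP ey; move: rxy; rewrite refill_out // refill_big //.
  have := unbump_lt ey; set u := unbump _ _ => uN fxy.
  have lx : level x <= N.-1 by move: mx my lxy; rewrite /middle; lia.
  have lxu : level x <= level (base u) by rewrite level_base.
  have [h1 h2] := chain_mono vf fxy lxu.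
  have [b1 b2] := base_coord uN; rewrite b1 b2 in h1 h2.
  have ney : y.2 <> (q (slot y)).1 :> nat by move/ord_inj.
  by move: h1 h2 ney my; rewrite /middle /level /grid_cmp /u /unbump; lia.
have [my|my] := boolP (middle y) => /=; last first.
  move=> /eqP ex _; move: rxy; rewrite refill_big // refill_out //.
  have := unbump_lt ex; set u := unbump _ _ => uN fxy.
  have [z [lz fz]] := @base_at f vf u (N + k + 1) uN ltac:(lia).
  have ly : N + k + 1 <= level y by move: mx my lxy; rewrite /middle; lia.
  have lzy : level z <= level y by rewrite lz.
  have [h1 h2] := chain_mono vf (etrans fz fxy) lzy.
  have zr := top_rank vf uN lz fz.
  have nex : x.2 <> (q (slot x)).1 :> nat by move/ord_inj.
  by move: h1 h2 nex mx lz zr; rewrite /middle /level /grid_cmp /u /unbump; lia.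
move=> /eqP ex /eqP ey; move: rxy; rewrite !refill_big //.
move=> /(base_inj vf (unbump_lt ex) (unbump_lt ey)).
have nex : x.2 <> (q (slot x)).1 :> nat by move/ord_inj.
have ney : y.2 <> (q (slot y)).1 :> nat by move/ord_inj.
have same : level x = level y -> (q (slot x)).1 = (q (slot y)).1 :> nat.
  by move=> e; rewrite /slot e.
have := qd (slot x) (slot y); rewrite !slotE //.
by move: same nex ney lxy mx my; rewrite /middle /level /grid_cmp /unbump; lia.
Qed.

Lemma grid_cmpC x y : grid_cmp x y = grid_cmp y x.
Proof. exact: orbC. Qed.

Lemma refill_valid f q : valid f -> valid_word q -> valid (refill f q).
Proof.
move=> vf vq; apply: valid_of_levels => [x y rxy|i iN].
  have [lxy|/ltnW lxy] := leqP (level x) (level y); first exact: refill_chain_le rxy lxy.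
  by rewrite grid_cmpC; apply: refill_chain_le (esym rxy) lxy.
have [l1 l2] := big_level vf iN; split=> [x|l hl].
  have [mx|mx] := boolP (middle x); last by rewrite refill_out //; apply: l1.
  by move=> _; move: mx; rewrite /middle; lia.
have [ml|ml] := boolP (N <= l <= N + k); last first.
  have [x [lx fx]] := l2 l hl; exists x; rewrite refill_out ?fx //.
  by rewrite /middle lx.
have [z [lz fz]] := @big_at f vf i N.-1 iN ltac:(lia).
have zN : z.2 < N.
  rewrite ltn_neqAle row_le andbT; apply/eqP => zN.
  by move: lz; rewrite /level; lia.
have bz : base z.2 = z.
  have [b1 b2] := base_coord zN; apply: grid_cell_eq => //.
  by move: lz; rewrite b1 /level; lia.
(* The rank of the colour is its row on level [N - 1]; on level [l] it moves to the row of that rank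
   among the rows other than [p]. *)
pose p := (q (inord (l - N))).1; pose j := bump p z.2.
have jN : j <= N by rewrite /j /bump; lia.
have [e1 e2] := @grid_cellK (l - j) j ltac:(lia) jN.
have lx : level (grid_cell (l - j) j) = l by rewrite /level e1 e2; lia.
have mx : middle (grid_cell (l - j) j) by rewrite /middle lx.
have sx : slot (grid_cell (l - j) j) = inord (l - N) by rewrite /slot lx.
exists (grid_cell (l - j) j); split => //; rewrite refill_big //; rewrite sx -/p.
  by rewrite e2 bumpK bz fz.
by move=> h; have := e2; rewrite h /j /bump; lia.
Qed.

Lemma refill_small_count f q (i : 'I_3) : valid f ->
  #|[set x : X | refill f q x == i :> nat]| = #|[set r | (q r).2 == i]|.
Proof.
move=> vf; have /fin_all_exists[c cP] := word_cell q.
rewrite -(card_imset (f := c)); last first.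
  by move=> r r' crr; have [_ <- _] := cP r; have [_ <- _] := cP r'; rewrite crr.
apply: eq_card => x; rewrite inE; apply/eqP/imsetP => [fx|[r]].
  have := refill_lt3 q x vf; rewrite fx ltn_ord => /esym/andP[mx /eqP ex].
  have [mc sc ec] := cP (slot x).
  exists (slot x); last by apply: slot_row_inj => //; rewrite ec.
  by rewrite inE; apply/eqP/ord_inj; rewrite -fx refill_small.
rewrite inE => /eqP qr ->; have [mc sc ec] := cP r.
by rewrite refill_small ?sc ?qr.
Qed.

Lemma word_of f : valid f -> exists q, valid_word q /\ refill f q = f.
Proof.
move=> vf; have /fin_all_exists[c cP] (r : 'I_k.+1) :
    exists x : X, level x = N + r /\ f x < 3.
  by apply: (small_at vf); have := ltn_ord r; lia.
pose q : word := [ffun r => ((c r).2, inord (f (c r)))].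
have q2 r : (q r).2 = f (c r) :> nat by rewrite ffunE inordK //; case: (cP r).
have q1 r : (q r).1 = (c r).2 by rewrite ffunE.
have mc r : middle (c r).
  by have [lc _] := cP r; rewrite /middle lc; have := ltn_ord r; lia.
have sc r : slot (c r) = r.
  by apply: ord_inj; rewrite slotE //; have [-> _] := cP r; lia.
have cs x : middle x -> level (c (slot x)) = level x.
  by move=> mx; have [-> _] := cP (slot x); rewrite slotE //; move: mx; rewrite /middle; lia.
(* If the small row rose from one level to the next, the big colour of rank [(c t).2] would sit one
   row above the small cell on the first level and drop by one row on the second, against the
   monotonicity of its chain. *)
have step m (r r' : 'I_k.+1) : r' = r + m :> nat -> (q r').1 <= (q r).1.
    elim: m r' => [|m IH] r' rm; first by rewrite (_ : r' = r) //; apply: ord_inj; lia.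
    have mk : r + m < k.+1 by have := ltn_ord r'; lia.
    apply: leq_trans (IH (Ordinal mk) erefl); rewrite !q1.
    set t := Ordinal mk; have [lt ft] := cP t; have [lr fr] := cP r'.
    rewrite leqNgt; apply/negP => lt_tr.
    have sN : (c t).2 < N by have := row_le (c r'); lia.
    have [x [lx fx]] := @base_at f vf (c t).2 (level (c t)) sN ltac:(rewrite lt /=; lia).
    have [y [ly fy]] := @base_at f vf (c t).2 (level (c r')) sN ltac:(rewrite lr; have := ltn_ord r'; lia).
    have xr := middle_rank vf ft sN lx fx.
    have yr := middle_rank vf fr sN ly fy.
    have [|_] := chain_mono vf (etrans fx (esym fy)).
      by rewrite lx ly lt lr /=; lia.
    by rewrite xr yr /bump; lia.
have dec (r r' : 'I_k.+1) : r <= r' -> (q r').1 <= (q r).1.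
  by move=> rr; apply: (step (r' - r)); lia.
exists q; split; first split.
- exact: dec.
(* Rows ascend along a chain and descend along the word, so a small colour keeps its row. *)
- have le (r r' : 'I_k.+1) : r <= r' -> (q r).2 = (q r').2 -> (q r).1 <= (q r').1.
    move=> rr /(congr1 val); rewrite /= !q2 !q1 => /ord_inj h.
    have [] := chain_mono vf h => //.
    by have [-> _] := cP r; have [-> _] := cP r'; lia.
  move=> r r' qrr; apply: ord_inj; have [rr|/ltnW rr] := leqP r r'.
    by apply/eqP; rewrite eqn_leq le // dec.
  by apply/eqP; rewrite eqn_leq dec // le.
- apply/ffunP => x; rewrite ffunE; case: ifP => // mx.
  have [_ fc] := cP (slot x); rewrite q1.
  case: eqP => xc.
    have cx : c (slot x) = x by apply: slot_row_inj; rewrite ?mc ?sc.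
    by apply: ord_inj; rewrite q2 cx inordK //; move: fc; rewrite cx; lia.
  rewrite -(middle_color vf fc) //; first by rewrite cs.
  by move=> h; apply: xc; rewrite -h.
Qed.


Definition colorings (a : 'I_3 -> nat) : {set col} :=
  [set f : col | `[< valid f >] &&
    [forall i : 'I_3, #|[set x : X | f x == i :> nat]| == a i]].

Definition words (a : 'I_3 -> nat) : {set word} :=
  [set q : word | `[< valid_word q >] &&
    [forall i : 'I_3, #|[set r | (q r).2 == i]| == a i]].

Let q0 : word := [ffun=> (ord0, ord0)].

Lemma valid_word0 : valid_word q0.
Proof. by split=> r r'; rewrite !ffunE. Qed.

(** One representative for each class of valid colourings that agree outside the middle levels. *)
Definition frames : {set col} := [set f : col | `[< valid f >] && (refill f q0 == f)].

Lemma frames_gt0 : 0 < #|frames|.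
Proof.
have [g vg] := exists_valid; apply/card_gt0P; exists (refill g q0).
rewrite inE refill_rep eqxx andbT; apply/asboolP.
exact: refill_valid vg valid_word0.
Qed.

Lemma refill_inj f g q q' : valid f -> valid g -> refill f q = refill g q' -> q = q'.
Proof.
move=> vf vg rE; apply/ffunP => r.
have [x [mx sx ex]] := word_cell q r.
have fx : refill f q x < 3 by rewrite refill_lt3 // mx sx ex eqxx.
have := fx; rewrite rE refill_lt3 // mx sx => /eqP ex'.
have h := refill_small f mx (etrans ex (congr1 (fun r => (q r).1) (esym sx))).
have h' := refill_small g mx (etrans ex' (congr1 (fun r => (q' r).1) (esym sx))).
rewrite rE h' sx in h; rewrite [q r]surjective_pairing [q' r]surjective_pairing.
by rewrite -ex ex' (ord_inj h).
Qed.

(** A colouring is a frame refilled with a word, in a unique way: its small cells give the word, and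
    refilling with [q0] recovers the frame. The sizes of the small classes depend on the word alone,
    so the number of frames is a common factor. *)
Lemma card_colorings a : #|colorings a| = #|frames| * #|words a|.
Proof.
rewrite -cardsX -(card_in_imset (f := fun fq => refill fq.1 fq.2)); last first.
  move=> [f q] [g q'] /=; rewrite !inE /= => /andP[/andP[/asboolP vf /eqP ff] _].
  move=> /andP[/andP[/asboolP vg /eqP gg] _] rE.
  by rewrite (refill_inj vf vg rE) -ff -gg -(refill_rep f q) rE refill_rep.
apply: eq_card => f; apply/idP/imsetP => [|[[g q]]]; rewrite !inE /=.
  move=> /andP[/asboolP vf /forallP fc]; have [q [vq rq]] := word_of vf.
  exists (refill f q0, q); last by rewrite /= refill_rep.
  rewrite !inE /= refill_rep eqxx andbT; apply/and3P; split; try exact/asboolP.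
    exact/asboolP/(refill_valid vf valid_word0).
  by apply/forallP => i; rewrite -(refill_small_count q i vf) rq; apply: fc.
move=> /andP[/andP[/asboolP vg _] /andP[/asboolP vq /forallP qc]] ->.
apply/andP; split; first exact/asboolP/refill_valid.
by apply/forallP => i; rewrite refill_small_count.
Qed.

End Grid.

(** * Counting words *)

Local Notation o0 := (Ordinal (isT : 0 < 3)).
Local Notation o1 := (Ordinal (isT : 1 < 3)).
Local Notation o2 := (Ordinal (isT : 2 < 3)).

Lemma ord3P (i : 'I_3) : [\/ i = o0, i = o1 | i = o2].
Proof.
case: i => [[|[|[|i]]] hi] //; [constructor 1|constructor 2|constructor 3];
  exact: ord_inj.
Qed.

Section Words.
Variables (K : nat) (a : 'I_3 -> nat).
Hypothesis aK : a o0 + a o1 + a o2 = K.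
Local Notation cword := {ffun 'I_K -> 'I_3}.

Definition content (c : cword) : bool := [forall i, #|[set r | c r == i]| == a i].

Lemma contentP (c : cword) : reflect (forall i, #|[set r | c r == i]| = a i) (content c).
Proof. by apply: (iffP forallP) => h i; apply/eqP. Qed.

Lemma count_codom (c : cword) i : count_mem i (codom c) = #|[set r | c r == i]|.
Proof.
rewrite count_map -size_filter.
rewrite -(card_uniqP (filter_uniq _ (enum_uniq _))); apply: eq_card => r.
by rewrite mem_filter mem_enum inE andbT.
Qed.

Section Fiber.
Variables (i j l : 'I_3) (B : {set 'I_K}).
Hypotheses (ij : i != j) (il : i != l) (jl : j != l) (BK : #|B| = a l).

Lemma sum_letters : a i + a j + a l = K.
Proof.
rewrite -aK; move: ij il jl.
by case: (ord3P i) => ->; case: (ord3P j) => ->; case: (ord3P l) => -> //=; lia.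
Qed.

Lemma third_letter m : m != i -> m != l -> m = j.
Proof.
move: ij il jl.
by case: (ord3P i) => ->; case: (ord3P j) => ->; case: (ord3P l) => ->;
   case: (ord3P m) => ->.
Qed.

(** With the positions of [l] fixed, only those of [i] among the other [a i + a j] remain to be
    chosen. *)
Lemma card_fiber :
  #|[set c : cword | content c && ([set r | c r == l] == B)]| = 'C(a i + a j, a i).
Proof.
pose f (A : {set 'I_K}) : cword := [ffun r => if r \in A then i else if r \in B then l else j].
have cBC : #|~: B| = a i + a j.
  by have := cardsC B; rewrite card_ord BK; have := sum_letters; lia.
have fi (A : {set 'I_K}) : A \subset ~: B -> [set r | f A r == i] = A.
  move=> AB; apply/setP => r; rewrite inE ffunE; case: ifP => rA; first by rewrite eqxx.
  by case: ifP => _; rewrite eq_sym; apply/negbTE.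
have fl (A : {set 'I_K}) : A \subset ~: B -> [set r | f A r == l] = B.
  move=> AB; apply/setP => r; rewrite inE ffunE; case: ifP => rA.
    by rewrite (negbTE il); have := subsetP AB r rA; rewrite inE => /negbTE ->.
  by case: ifP => _; rewrite ?eqxx ?(negbTE jl).
rewrite -cBC -cards_draws -(card_in_imset (f := f)); last first.
  move=> A A'; rewrite !inE => /andP[AB _] /andP[AB' _] fAA.
  by rewrite -(fi A AB) fAA fi.
apply: eq_card => c; rewrite inE; apply/andP/imsetP => [[/contentP cc /eqP cB]|].
  exists [set r | c r == i].
    rewrite inE cc eqxx andbT; apply/subsetP => r; rewrite -cB !inE => /eqP ->.
    exact: il.
  apply/ffunP => r; rewrite ffunE inE -cB inE; case: eqP => // /eqP ni.
  by case: eqP => // /eqP nl; apply: third_letter.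
move=> [A]; rewrite inE => /andP[AB /eqP Ai] ->; split; last by rewrite fl.
have fj : [set r | f A r == j] = ~: B :\: A.
  apply/setP => r; rewrite !inE ffunE; case: ifP => rA /=; first exact/negbTE.
  by case: ifP => _; rewrite ?eqxx // eq_sym; apply/negbTE.
apply/contentP => m; have [->|mi] := eqVneq m i; first by rewrite fi.
have [->|ml] := eqVneq m l; first by rewrite fl.
rewrite (third_letter mi ml) fj cardsD (setIidPr AB) cBC Ai; lia.
Qed.

End Fiber.

Lemma card_content :
  #|[set c : cword | content c]| = 'C(K, a o2) * 'C(a o0 + a o1, a o0).
Proof.
rewrite -sum1_card (partition_big (fun c : cword => [set r | c r == o2])
   (fun B : {set 'I_K} => #|B| == a o2)); last first.
  by move=> c; rewrite inE => /contentP ->.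
rewrite (eq_bigr (fun=> 'C(a o0 + a o1, a o0))).
  rewrite sum_nat_const; congr (_ * _).
  by rewrite -[in RHS](card_ord K) -card_draws; apply: eq_card => B; rewrite !inE.
move=> B /eqP BK; rewrite -(@card_fiber o0 o1 o2 B) // sum1dep_card.
by apply: eq_card => c; rewrite !inE.
Qed.

Section Rows.
Variables (n : nat) (g : 'I_3 -> 'I_n).

Definition descending (c : cword) : bool :=
  [forall r : 'I_K, forall r' : 'I_K, (r <= r') ==> (g (c r') <= g (c r))].

Lemma descendingP (c : cword) :
  reflect (forall r r' : 'I_K, r <= r' -> g (c r') <= g (c r)) (descending c).
Proof.
apply: (iffP forallP) => [h r r' rr|h r]; first by have /forallP/(_ r')/implyP := h r; apply.
by apply/forallP => r'; apply/implyP; apply: h.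
Qed.

Lemma content_perm (c c' : cword) : content c -> content c' ->
  perm_eq (codom c) (codom c').
Proof.
move=> /contentP cc /contentP cc'; apply/allP => i _ /=.
by rewrite !count_codom cc cc'.
Qed.

Let ge (u v : 'I_n) := v <= u.

Lemma nth_letters (c : cword) (i0 : 'I_n) (r : 'I_K) :
  nth i0 [seq g i | i <- codom c] r = g (c r).
Proof.
rewrite (nth_map o0); last by rewrite size_codom card_ord.
by rewrite (nth_map r) ?size_enum_ord // nth_ord_enum.
Qed.

Lemma descending_sorted (c : cword) :
  descending c = sorted ge [seq g i | i <- codom c].
Proof.
have ge_trans : transitive ge by move=> u v t uv ut; apply: leq_trans ut uv.
have ge_refl : reflexive ge by move=> u; apply: leqnn.
have sz : size [seq g i | i <- codom c] = K by rewrite size_map size_codom card_ord.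
apply/descendingP/idP => [h|s r r' rr]; last first.
  have := sorted_leq_nth ge_trans ge_refl (g o0) s; rewrite sz => /(_ r r').
  rewrite !inE !nth_letters; apply=> //; exact: ltn_ord.
apply/(sortedP (g o0)) => r; rewrite sz => rK.
have := nth_letters c (g o0) (Ordinal rK); rewrite /= => ->.
have := nth_letters c (g o0) (Ordinal (ltnW rK)); rewrite /= => ->.
by apply: h => /=.
Qed.

(** A descending sequence of rows is the sorted form of a multiset that depends only on the
    content. *)
Lemma descending_letters (c c' : cword) : content c -> content c' ->
  descending c -> descending c' -> forall r, g (c r) = g (c' r).
Proof.
move=> cc cc'; rewrite !descending_sorted => s s' r.
have ss : [seq g i | i <- codom c] = [seq g i | i <- codom c'].
  apply: (sorted_eq (leT := ge)) => //.
  - by move=> u v t uv ut; apply: leq_trans ut uv.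
  - by move=> u v /andP[uv vu]; apply/ord_inj/anti_leq; rewrite [u <= v]vu [v <= u]uv.
  - exact/perm_map/content_perm.
by rewrite -(nth_letters c (g o0)) ss nth_letters.
Qed.

Lemma exists_descending : exists c, content c /\ descending c.
Proof.
pose s0 := nseq (a o0) o0 ++ nseq (a o1) o1 ++ nseq (a o2) o2.
pose s := sort (fun i j => ge (g i) (g j)) s0.
have sK : size s = K by rewrite size_sort !size_cat !size_nseq addnA.
pose c : cword := [ffun r => nth o0 s (r : 'I_K)].
have cs : codom c = s.
  apply: (@eq_from_nth _ o0); rewrite size_codom card_ord ?sK // => r rK.
  have := nth_map (Ordinal rK) o0 c (n := r) (s := enum 'I_K).
  rewrite size_enum_ord => /(_ rK) ->.
  by rewrite (nth_ord_enum _ (Ordinal rK)) ffunE.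
exists c; split.
  apply/contentP => i.
  rewrite -count_codom cs (permP (permEl (perm_sort _ _))) !count_cat !count_nseq.
  by case: (ord3P i) => -> /=; lia.
rewrite descending_sorted cs sorted_map; apply: sort_sorted => i j.
exact: leq_total.
Qed.

Definition fills : {set cword} := [set c | content c && descending c].

(** This replaces the order condition by agreement with a reference word: letters may be exchanged
    only within the positions of one row. *)
Lemma fills_ref : exists2 c0, content c0 &
  forall c, (c \in fills) = content c && [forall r, g (c r) == g (c0 r)].
Proof.
have [c0 [cc0 d0]] := exists_descending; exists c0 => // c.
rewrite inE; apply: andb_id2l => cc; apply/idP/forallP => [d r|h].
  exact/eqP/descending_letters.
apply/descendingP => r r' rr; rewrite !(eqP (h _)).
by move/descendingP: d0; apply.
Qed.

Lemma card_fills_inj : injective g -> #|fills| = 1.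
Proof.
move=> gi; have [c0 cc0 h] := fills_ref; apply/eqP/cards1P; exists c0.
apply/setP => c; rewrite h inE; apply/andP/eqP => [[_ /forallP gc]|->].
  by apply/ffunP => r; apply/gi/eqP.
by split => //; apply/forallP.
Qed.

Lemma card_fills_const : (forall i, g i = g o0) ->
  #|fills| = 'C(K, a o2) * 'C(a o0 + a o1, a o0).
Proof.
move=> gc; rewrite -card_content; apply: eq_card => c; rewrite !inE.
rewrite (_ : descending c) ?andbT //; apply/descendingP => r r' _.
by rewrite gc [g (c r)]gc.
Qed.

(** The reference word fixes the positions of [l], while [i] and [j] are distributed freely over the
    rest. *)
Lemma card_fills_two i j l : i != j -> i != l -> j != l -> g i = g j -> g i != g l ->
  #|fills| = 'C(a i + a j, a i).
Proof.
move=> ij il jl gij gil; have [c0 cc0 h] := fills_ref.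
rewrite -(@card_fiber i j l [set r | c0 r == l]) //; last exact/contentP.
have gE m m' : (g m == g m') = ((m == l) == (m' == l)).
  have gm t : g t = if t == l then g l else g i.
    case: eqP => [-> //|/eqP tl]; case: (eqVneq t i) => [-> //|ti].
    by rewrite (third_letter ij il jl ti tl).
  rewrite gm [g m']gm; case: ifP; case: ifP; rewrite ?eqxx //= => _ _.
    by rewrite eq_sym; apply/negbTE.
  exact/negbTE.
apply: eq_card => c; rewrite h [in RHS]inE; congr (_ && _).
apply/forallP/eqP => [e|e r].
  by apply/setP => r; have := e r; rewrite gE !inE => /eqP.
by have /setP/(_ r) := e; rewrite !inE gE => ->.
Qed.

End Rows.
End Words.

Lemma sum_pick_one n (v : 'I_n.+1) p q :
  \sum_(w < n.+1) (if v == w then p else q) = p + n * q.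
Proof.
rewrite (bigD1 v) //= eqxx; congr (_ + _).
rewrite (eq_bigr (fun=> q)) => [|w wv]; last by rewrite eq_sym (negbTE wv).
by rewrite sum_nat_const cardC1 card_ord.
Qed.

Lemma sum_pick_two n (u v : 'I_n.+1) p q : u != v ->
  \sum_(w < n.+1) (if u == w then p else if v == w then q else 1) = p + q + n.-1.
Proof.
move=> uv; have vu : v != u by rewrite eq_sym.
rewrite (bigD1 u) //= eqxx (bigD1 v) //= (negbTE uv) eqxx addnA; congr (_ + _).
rewrite (eq_bigr (fun=> 1)) => [|w /andP[wu wv]].
  rewrite sum1dep_card (_ : [set _ | _] = ~: [set u; v]).
    by have := cardsC [set u; v]; rewrite cards2 uv card_ord; lia.
  by apply/setP => w; rewrite !inE negb_or.
by rewrite ![_ == w]eq_sym (negbTE wu) (negbTE wv).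
Qed.

(** * Closed formulas, by coincidences among the rows of the three colours *)

Section CountWords.
Variables (N k : nat) (a : 'I_3 -> nat).
Hypotheses (ak : a o0 + a o1 + a o2 = k.+1) (a1 : 0 < a o1) (a2 : 0 < a o2).
Local Notation row := 'I_N.+1.

Definition rows3 (t : row * row * row) (i : 'I_3) : row :=
  if i == o0 then t.1.1 else if i == o1 then t.1.2 else t.2.

Lemma card_fills_rows3 (u v w : row) :
  #|fills k.+1 a (rows3 (u, v, w))| =
  if u == v then (if v == w then 'C(k.+1, a o2) * 'C(a o0 + a o1, a o0)
                  else 'C(a o0 + a o1, a o0))
  else if u == w then 'C(a o0 + a o2, a o0)
  else if v == w then 'C(a o1 + a o2, a o1) else 1.
Proof.
case: (eqVneq u v) => [->|uv].
  case: (eqVneq v w) => [->|vw].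
    by apply: card_fills_const => // i; case: (ord3P i) => ->.
  by rewrite (@card_fills_two _ _ ak _ _ o0 o1 o2).
case: (eqVneq u w) uv => [-> uv|uw uv].
  exact: (@card_fills_two _ _ ak _ (rows3 (w, v, w)) o0 o2 o1 isT isT isT erefl uv).
case: (eqVneq v w) uv => [-> uv|vw uv].
  by rewrite eq_sym in uv; exact: (@card_fills_two _ _ ak _ (rows3 (u, w, w)) o1 o2 o0 isT isT isT erefl uv).
apply: card_fills_inj => // i j; rewrite /rows3.
by case: (ord3P i) => ->; case: (ord3P j) => -> //= e; move: uv uw vw; rewrite e ?eqxx.
Qed.

(* When no letter is [0], the row assigned to [0] is tied to that of [1], so that
   a word still determines the assignment of rows. *)
Definition tied (t : row * row * row) : bool := (a o0 == 0) ==> (t.1.1 == t.1.2).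

(** A word amounts to a row for each colour together with a filling. Colours 1 and 2 occur, so the
    word determines their rows. *)
Lemma card_words_sum :
  #|words N k a| = \sum_(t | tied t) #|fills k.+1 a (rows3 t)|.
Proof.
have occurs (c : {ffun 'I_k.+1 -> 'I_3}) i : content a c -> 0 < a i -> exists r, c r = i.
  move=> /contentP cc; rewrite -cc => /card_gt0P[r]; rewrite inE => /eqP cr.
  by exists r.
pose P (tc : (row * row * row) * {ffun 'I_k.+1 -> 'I_3}) :=
  tied tc.1 && (tc.2 \in fills k.+1 a (rows3 tc.1)).
pose h (tc : (row * row * row) * {ffun 'I_k.+1 -> 'I_3}) :
  {ffun 'I_k.+1 -> row * 'I_3} := [ffun r => (rows3 tc.1 (tc.2 r), tc.2 r)].
transitivity #|[set tc | P tc]|; last first.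
  rewrite -sum1dep_card -(pair_big_dep tied
    (fun t c => c \in fills k.+1 a (rows3 t)) (fun _ _ => 1)) /=.
  by apply: eq_bigr => t _; rewrite sum1_card.
rewrite -(card_in_imset (f := h)); last first.
  move=> [[[u v] w] c] [[[u' v'] w'] c']; rewrite !inE /P /= !inE.
  move=> /andP[t /andP[cc _]] /andP[t' /andP[cc' _]] /ffunP hh.
  have cE : c = c' by apply/ffunP => r; have := hh r; rewrite !ffunE => -[].
  have g i r : c r = i -> rows3 (u, v, w) i = rows3 (u', v', w') i.
    by move=> <-; have := hh r; rewrite !ffunE -cE => -[].
  have [r1 /g e1] := occurs c o1 cc a1; have [r2 /g e2] := occurs c o2 cc a2.
  rewrite /rows3 /= in e1 e2; rewrite -cE -e1 -e2.
  suff -> : u = u' by [].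
  case: (posnP (a o0)) => [a0|a0].
    by move: t t'; rewrite /tied a0 /= => /eqP -> /eqP ->.
  by have [r0 /g] := occurs c o0 cc a0.
apply: eq_card => q; rewrite inE; apply/andP/imsetP.
  move=> [/asboolP[qd qc] /forallP qa].
  pose c : {ffun 'I_k.+1 -> 'I_3} := [ffun r => (q r).2].
  have cc : content a c.
    apply/contentP => i; rewrite -(eqP (qa i)); apply: eq_card => r.
    by rewrite !inE ffunE.
  have rowP i : exists u : row, forall r, c r = i -> (q r).1 = u.
    case: (pselect (exists r, c r = i)) => [[r cr]|nr].
      by exists (q r).1 => r' cr'; apply: qc; have := etrans cr' (esym cr); rewrite !ffunE.
    by exists ord0 => r cr; case: nr; exists r.
  have [u hu] := rowP o0; have [v hv] := rowP o1; have [w hw] := rowP o2.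
  pose u' := if a o0 == 0 then v else u.
  have rE r : rows3 (u', v, w) (c r) = (q r).1.
    case: (ord3P (c r)) => cr; rewrite cr /rows3 /=.
    - rewrite /u'; case: eqP => [a0|_]; last by rewrite (hu r cr).
      by move: a0; rewrite -(elimT (contentP _ _) cc) => /eqP; rewrite cards_eq0 => /eqP/setP/(_ r); rewrite !inE cr.
    - by rewrite (hv r cr).
    - by rewrite (hw r cr).
  exists ((u', v, w), c); last first.
    by apply/ffunP => r; rewrite ffunE /= rE ffunE -surjective_pairing.
  rewrite inE /P /tied /= /u'; apply/andP; split.
    by case: eqP => // _; rewrite eqxx.
  rewrite inE cc; apply/descendingP => r r' rr; rewrite !rE; exact: qd.
move=> [[t c]]; rewrite inE /P /= inE => /andP[_ /andP[/contentP cc /descendingP cd]] ->.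
split.
  apply/asboolP; split=> r r'; rewrite !ffunE /=; first exact: cd.
  by move=> ->.
by apply/forallP => i; rewrite -cc; apply/eqP/eq_card => r; rewrite !inE ffunE.
Qed.

Lemma card_words0 : a o0 = 0 -> #|words N k a| = N.+1 * ('C(k.+1, a o2) + N).
Proof.
move=> a0; rewrite card_words_sum.
pose F (u v w : row) := #|fills k.+1 a (rows3 (u, v, w))|.
transitivity (\sum_(uv : row * row | uv.1 == uv.2) \sum_(w : row) F uv.1 uv.2 w).
  rewrite pair_big /=; apply: eq_big => [t|[[u v] w] _ //].
  by rewrite /tied a0 andbT.
transitivity (\sum_(u : row) \sum_(v : row | u == v) \sum_(w : row) F u v w).
  symmetry; exact: (pair_big_dep xpredT (fun u v : row => u == v)
    (fun u v => \sum_(w : row) F u v w)).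
rewrite (eq_bigr (fun=> 'C(k.+1, a o2) + N)).
  by rewrite sum_nat_const card_ord.
move=> u _; rewrite (big_pred1 u); last by move=> v; rewrite eq_sym.
under eq_bigr => w _ do rewrite /F card_fills_rows3 eqxx.
by rewrite sum_pick_one a0 !bin0 !muln1.
Qed.

(** For fixed [u], the case [v = u] gives one term with all rows equal and [N] with [w] apart. For
    each of the [N] other [v], the row [w] equals [u], equals [v], or is one of [N - 1] others,
    where the word is forced. *)
Lemma card_words_pos : 0 < N -> 0 < a o0 ->
  #|words N k a| = N.+1 * ('C(k.+1, a o2) * 'C(a o0 + a o1, a o0) +
    N * ('C(a o0 + a o1, a o0) + 'C(a o0 + a o2, a o0) + 'C(a o1 + a o2, a o1) + N.-1)).
Proof.
move=> N_gt0 a0; rewrite card_words_sum.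
pose F (u v w : row) := #|fills k.+1 a (rows3 (u, v, w))|.
transitivity (\sum_(uv : row * row) \sum_(w : row) F uv.1 uv.2 w).
  rewrite pair_big /=; apply: eq_big => [t|[[u v] w] _ //].
  by rewrite /tied; case: (a o0) a0.
transitivity (\sum_(u : row) \sum_(v : row) \sum_(w : row) F u v w).
  symmetry; exact: (pair_bigA _ (fun u v : row => \sum_(w : row) F u v w)).
pose A := 'C(k.+1, a o2) * 'C(a o0 + a o1, a o0).
pose B := 'C(a o0 + a o1, a o0).
pose C := 'C(a o0 + a o2, a o0) + 'C(a o1 + a o2, a o1) + N.-1.
rewrite (eq_bigr (fun=> A + N * B + N * C)).
  by rewrite sum_nat_const card_ord /A /B /C -!addnA -!mulnDr !addnA.
move=> u _; rewrite -(sum_pick_one u (A + N * B) C); apply: eq_bigr => v _; rewrite /F.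
under eq_bigr => w _ do rewrite card_fills_rows3.
case: (eqVneq u v) => [_|uv]; first by rewrite sum_pick_one.
exact: sum_pick_two.
Qed.

End CountWords.

(** * The numerical inequality *)

Definition letters (x y z : nat) (i : 'I_3) : nat := nth 0 [:: x; y; z] i.

Lemma card_words_lt N c : 1 < c -> c + 3 <= 2 * N ->
  #|words N (c + 3) (letters 2 2 c)| + #|words N (c + 3) (letters 1 1 c.+2)|
    + #|words N (c + 3) (letters 0 3 c.+1)|
  < #|words N (c + 3) (letters 1 2 c.+1)| + #|words N (c + 3) (letters 1 3 c)|
    + #|words N (c + 3) (letters 0 2 c.+2)|.
Proof.
move=> c1 cN; have N0 : 0 < N by lia.
rewrite (@card_words0 N (c + 3) (letters 0 3 c.+1))
  ?(@card_words0 N (c + 3) (letters 0 2 c.+2)) ?card_words_pos //=;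
  rewrite /letters /=; try lia.
rewrite (_ : (c + 3).+1 = 4 + c); last by lia.
(* Constant lower indices turn the binomials into polynomials in [c]. *)
have flip d : d <= 4 + c -> 'C(4 + c, 4 + c - d) = 'C(4 + c, d) by move/bin_sub.
have -> : 'C(4 + c, c) = 'C(4 + c, 4) by rewrite -(flip 4) ?addKn //; lia.
have -> : 'C(4 + c, c.+1) = 'C(4 + c, 3).
  by rewrite -(flip 3); [congr 'C(_, _)|]; lia.
have -> : 'C(4 + c, c.+2) = 'C(4 + c, 2).
  by rewrite -(flip 2); [congr 'C(_, _)|]; lia.
rewrite !bin1 (_ : 'C(2 + 2, 2) = 6) // -!mulnDr ltn_pmul2l //.
have h4 : 'C(4 + c, 4) * 24 = (4 + c) * ((3 + c) * ((2 + c) * (1 + c))).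
  by rewrite (_ : 24 = 4`!) // bin_ffact !ffactnS ffactn0 muln1.
have h3 : 'C(4 + c, 3) * 6 = (4 + c) * ((3 + c) * (2 + c)).
  by rewrite (_ : 6 = 3`!) // bin_ffact !ffactnS ffactn0 muln1.
have h2 : 'C(4 + c, 2) * 2 = (4 + c) * (3 + c).
  by rewrite (_ : 2 = 2`!) // bin_ffact !ffactnS ffactn0 muln1.
have e3 : 'C(3 + c, 3) * 6 = (3 + c) * ((2 + c) * (1 + c)).
  by rewrite (_ : 6 = 3`!) // bin_ffact !ffactnS ffactn0 muln1.
have e2 : 'C(2 + c.+1, 2) * 2 = (3 + c) * (2 + c).
  rewrite addnS -addSn [X in _ * X = _](_ : 2 = 2`!) //.
  by rewrite bin_ffact !ffactnS ffactn0 muln1.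
have d2 : 'C(2 + c, 2) * 2 = (2 + c) * (1 + c).
  by rewrite [X in _ * X = _](_ : 2 = 2`!) // bin_ffact !ffactnS ffactn0 muln1.
move: h4 h3 h2 e3 e2 d2.
move: 'C(4 + c, 4) 'C(4 + c, 3) 'C(4 + c, 2) 'C(3 + c, 3) 'C(2 + c.+1, 2) 'C(2 + c, 2).
move=> b4 b3 b2 e3 e2 d2 h4 h3 h2 he3 he2 hd2.
(* After division by [N.+1] the words using three rows cancel. [beta] compares the coefficients of
   [N], coming from two rows, and [alpha] the contributions of words in a single row. *)
have beta : 6 * (e2 + e3) = 6 * (2 * d2 + 4) + (c - 1) * (c * c + 4 * c + 12).
  by nia.
have alpha : 12 * (2 * b4 + b2) = 12 * (2 * b3) + (4 + c) * ((3 + c) * (c * (c - 1))).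
  by nia.
(* Strictness comes from [(4 + c) * c < c * c + 4 * c + 12] and [0 < c - 1]; the factor [3 + c] is
   then at most [2 * N]. *)
have key : (4 + c) * ((3 + c) * (c * (c - 1))) < 2 * N * ((c - 1) * (c * c + 4 * c + 12)).
  apply: (@leq_trans ((3 + c) * ((c - 1) * (c * c + 4 * c + 12)))).
    have -> : (4 + c) * ((3 + c) * (c * (c - 1))) = (3 + c) * ((c - 1) * (c * c + 4 * c)).
      by rewrite mulnCA (mulnC c (c - 1)) [in LHS]mulnCA mulnDl; lia.
    by rewrite !ltn_pmul2l; lia.
  by rewrite leq_mul2r; lia.
have nbeta : 6 * (N * (e2 + e3)) =
    6 * (N * (2 * d2 + 4)) + N * ((c - 1) * (c * c + 4 * c + 12)).
  by rewrite mulnCA beta mulnDr mulnCA.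
have main : 2 * b4 + b2 + N * (2 * d2 + 4) < 2 * b3 + N * (e2 + e3).
  move: key alpha nbeta; rewrite -mulnA; move: (N * (e2 + e3)) (N * (2 * d2 + 4)).
  by move: (N * _) ((4 + c) * _) => *; lia.
by clear -main; nia.
Qed.

(** * Monomial coefficients as counts, and the conclusion *)

Definition expvec_of_seq (s : seq nat) : expvec :=
  [fsfun i in seq_fset tt (iota 0 (size s)) => nth 0 s i].

Lemma expvec_of_seqE s i : expvec_of_seq s i = nth 0 s i.
Proof.
rewrite /expvec_of_seq fsfun_fun seq_fsetE mem_iota /= add0n.
by case: ltnP => // si; rewrite nth_default.
Qed.

Lemma schur_expvec_of_seq la x y z w : 
  schur la (expvec_of_seq [:: x, y, z & w]) = (#|tableaux la w x y z|%:R)%R.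
Proof.
rewrite /schur (@genseries_card _ _ _ (size w).+3); last first.
  by move=> i hi; rewrite expvec_of_seqE nth_default.
congr (_%:R)%R; apply: eq_card => T; rewrite !inE; congr (_ && _).
by apply: eq_forallb => u; rewrite expvec_of_seqE.
Qed.

Definition big_sizes N k := [seq 2 * N + k + 1 - 2 * i | i <- iota 0 N].

(** Properness means that cells of one colour are comparable. The exponents from index 3 on give the
    class sizes in [valid], the first three the content of the small colours. *)
Lemma chromatic_expvec_of_seq N k x y z :
  chromatic_symfun (@inc _ ('I_(N.+1 + k) *p 'I_N.+1)%type)
    (expvec_of_seq [:: x, y, z & big_sizes N k])
  = (#|colorings N k (letters x y z)|%:R)%R.
Proof.
have sz : size (big_sizes N k) = N by rewrite size_map size_iota.
rewrite /chromatic_symfun (@genseries_card _ _ _ N.+3); last first.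
  by move=> i hi; rewrite expvec_of_seqE nth_default //= sz.
congr (_%:R)%R; apply: eq_card => f; rewrite !inE.
have cmpE (u v : 'I_(N.+1 + k) *p 'I_N.+1) : inc u v = ~~ grid_cmp u v.
  by rewrite /inc /Order.comparable !leEprod !leEord.
have bigE i : i < N -> expvec_of_seq [:: x, y, z & big_sizes N k] i.+3 = 2 * N + k + 1 - 2 * i.
  by move=> iN; rewrite expvec_of_seqE /= (nth_map 0) ?size_iota // nth_iota.
apply/andP/andP => [[/asboolP pf /forallP cf]|[/asboolP vf /forallP cf]].
  split; [apply/asboolP; split|].
  - move=> u v fuv; apply: contraPT (congr1 val fuv) => nuv.
    by have := pf u v; rewrite cmpE => /(_ nuv); rewrite !ffunE.
  - move=> i iN; have iM : i.+3 < N.+3 by [].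
    by rewrite -bigE // -(eqP (cf (Ordinal iM))); apply: eq_card => u; rewrite !inE.
  - apply/forallP => i; have iM : i < N.+3 by apply: leq_trans (ltn_ord i) _.
    have := cf (Ordinal iM); rewrite expvec_of_seqE /= => /eqP h.
    apply/eqP; transitivity (nth 0 [:: x, y, z & big_sizes N k] i).
      by rewrite -h; apply: eq_card => u; rewrite !inE.
    by case: i {iM h} => [[|[|[|i]]] hi].
split; [apply/asboolP => u v|].
  rewrite cmpE !ffunE => /negP nuv fuv; apply: nuv; apply: vf.1; exact: ord_inj.
apply/forallP => i; apply/eqP.
have [i3|i3] := ltnP i 3.
  have /eqP := cf (Ordinal i3).
  rewrite expvec_of_seqE; case: i i3 => [[|[|[|i]]] hi] //= i3 <-;
    by apply: eq_card => u; rewrite !inE.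
have iN : i - 3 < N by have := ltn_ord i; lia.
rewrite (_ : nat_of_ord i = (i - 3).+3); last by lia.
rewrite bigE // -(vf.2 _ iN); apply: eq_card => u; rewrite !inE -val_eqE /=.
by congr (_ == _); lia.
Qed.

Theorem theorem4p1 (n k : nat) (hk : (5 <= k)%N) (hn : (k + 2 <= 2 * n)%N) :
  ~ schur_positive ('I_(n + k) *p 'I_n)%type.
Proof.
case: n hn => [|N] hn; first by lia.
move=> [coef [coef_ge0 coefE]].
(* With [c = k - 3] the six contents are written without subtraction. *)
have [c [c1 kE]] : exists c, 1 < c /\ k = c + 3 by exists (k - 3); lia.
subst k; set w := big_sizes N (c + 3).
pose F m := chromatic_symfun (@inc _ ('I_(N.+1 + (c + 3)) *p 'I_N.+1)%type) m.
(* A nonnegative Schur expansion would inherit the tableau inequality term by term. *)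
have le : (F (expvec_of_seq [:: 1, 2, c.+1 & w]) + F (expvec_of_seq [:: 1, 3, c & w]) +
    F (expvec_of_seq [:: 0, 2, c.+2 & w]) <= F (expvec_of_seq [:: 2, 2, c & w]) +
    F (expvec_of_seq [:: 1, 1, c.+2 & w]) + F (expvec_of_seq [:: 0, 3, c.+1 & w]))%R.
  rewrite /F !coefE -!big_split /=; apply: ler_sum => la _.
  rewrite -!mulrDr !schur_expvec_of_seq -!natrD; apply: ler_wpM2l; first exact: coef_ge0.
  by rewrite ler_nat card_tableaux_le.
move: le; rewrite /F !chromatic_expvec_of_seq -!natrD ler_nat leqNgt => /negP; apply.
(* The positive common factor [#|frames|] cancels, and the word counts give the opposite strict
   inequality. *)
rewrite !card_colorings; try lia.
by rewrite -!mulnDr ltn_pmul2l ?frames_gt0 ?card_words_lt //; lia.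
Qed.
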